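(* Let $a\in(0,1)$ and let $\Sigma_r=\{r\}\times\mathbb{S}^2$ be a slice of the deSitter-Schwarzschild manifold $(\mathbb{R}\times\mathbb{S}^2,g_a)$. Then there exists $\epsilon=\epsilon(r)>0$ such that if $\Sigma\subset\mathbb{R}\times\mathbb{S}^2$ is an embedded two-sphere which is a normal graph over $\Sigma_r$ given by a function $\varphi\in C^2(\Sigma_r)$ with $\|\varphi\|_{C^2(\Sigma_r)}<\epsilon$, then (i) either $m_{\mathrm H}(\Sigma)<m_{\mathrm H}(\Sigma_r)$; (ii) or $\Sigma$ is a slice $\Sigma_s=\{s\}\times\mathbb{S}^2$ for some $s$.
   Context: For $a\in(0,1)$, the deSitter-Schwarzschild metric on $\mathbb{R}\times\mathbb{S}^2$ is $g_a=dr^2+u_a(r)^2g_{\mathbb{S}^2}$, where $g_{\mathbb{S}^2}$ is the round metric of Gauss curvature $1$ and $u_a:\mathbb{R}\to(0,\infty)$ is the (periodic) solution of $u''=\frac12\left(\frac{1-(u')^2}{u}\right)-\frac{u}{2}$ with $u_a(0)=a=\min u_a$ and $u_a'(0)=0$. It has constant scalar curvature $2$. The normal graph over $\Sigma_r$ given by $\varphi$ is $\{\exp_x(\varphi(x)\nu(x)):x\in\Sigma_r\}$, where $\nu=\partial_r$ is the unit normal; that is, $\{(r+\varphi(x),x):x\in\mathbb{S}^2\}$ after identifying $\Sigma_r$ with $\mathbb{S}^2$. The Hawking mass of a compact surface $\Sigma$ in a Riemannian three-manifold $(M,g)$ is $$m_{\mathrm H}(\Sigma)=\left(\frac{|\Sigma|}{16\pi}\right)^{1/2}\left(1-\frac1{16\pi}\int_\Sigma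 H^2\,d\sigma-\frac{\Lambda}{24\pi}|\Sigma|\right),$$ where $|\Sigma|$ is the area, $H$ is the mean curvature (trace of the second fundamental form), and $\Lambda=\inf_M R$ with $R$ the scalar curvature of $M$; here $\Lambda=2$. *)

(* Defs.v *)
From Stdlib Require Import Reals.
From Coquelicot Require Import Coquelicot.
Open Scope R_scope.

(** * Tensor calculus in coordinates on R^3 *)

Inductive ix : Set := i0 | i1 | i2.

Definition vec : Type := ix -> R.

(* Cyclic successor of an index: with it, 3x3 cofactors and the components of
   a cross product need no explicit signs. *)
Definition nxt (i : ix) : ix :=
  match i with i0 => i1 | i1 => i2 | i2 => i0 end.

Definition ix_eqb (i j : ix) : bool :=
  match i, j with
  | i0, i0 | i1, i1 | i2, i2 => true
  | _, _ => false
  end.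

Definition sum3 (f : ix -> R) : R := f i0 + f i1 + f i2.

Definition mkvec (a b c : R) : vec :=
  fun i => match i with i0 => a | i1 => b | i2 => c end.

Definition upd (x : vec) (i : ix) (t : R) : vec :=
  fun j => if ix_eqb i j then t else x j.

Definition partial (i : ix) (f : vec -> R) (x : vec) : R :=
  Derive (fun t => f (upd x i t)) (x i).

Definition ex_partial (i : ix) (f : vec -> R) (x : vec) : Prop :=
  ex_derive (fun t => f (upd x i t)) (x i).

Definition dot (v w : vec) : R := sum3 (fun i => v i * w i).
Definition enorm (v : vec) : R := sqrt (dot v v).

Definition cross (v w : vec) : vec :=
  fun i => v (nxt i) * w (nxt (nxt i)) - v (nxt (nxt i)) * w (nxt i).

Definition mat : Type := ix -> ix -> R.

Definition cofactor (A : mat) (i j : ix) : R :=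
  A (nxt i) (nxt j) * A (nxt (nxt i)) (nxt (nxt j))
  - A (nxt i) (nxt (nxt j)) * A (nxt (nxt i)) (nxt j).

Definition det3 (A : mat) : R := sum3 (fun j => A i0 j * cofactor A i0 j).

Definition inv3 (A : mat) : mat := fun i j => cofactor A j i / det3 A.

(** * Riemannian geometry in a coordinate chart *)

Definition metric : Type := vec -> mat.

Definition inner (g : metric) (x v w : vec) : R :=
  sum3 (fun i => sum3 (fun j => g x i j * v i * w j)).

(* [christoffel g k i j x] is Gamma^k_{ij}. *)
Definition christoffel (g : metric) (k i j : ix) (x : vec) : R :=
  / 2 * sum3 (fun l => inv3 (g x) k l *
    (partial i (fun y => g y j l) x + partial j (fun y => g y i l) x
     - partial l (fun y => g y i j) x)).

Definition ricci (g : metric) (j k : ix) (x : vec) : R :=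
  sum3 (fun i =>
    partial i (christoffel g i j k) x - partial j (christoffel g i i k) x
    + sum3 (fun p => christoffel g i i p x * christoffel g p j k x
                     - christoffel g i j p x * christoffel g p i k x)).

Definition scalar_curvature (g : metric) (x : vec) : R :=
  sum3 (fun j => sum3 (fun k => inv3 (g x) j k * ricci g j k x)).

Definition inf_scalar_curvature (g : metric) (U : vec -> Prop) : R :=
  real (Glb_Rbar (fun y => exists x, U x /\ y = scalar_curvature g x)).

(** ** Parametrized surfaces *)

Definition surface : Type := R -> R -> vec.

Definition d1 (F : surface) : surface := fun s t i => Derive (fun z => F z t i) s.
Definition d2 (F : surface) : surface := fun s t i => Derive (fun z => F s z i) t.

Section Surface.

Variables (g : metric) (F : surface).

Definition first_form (X Y : surface) (s t : R) : R :=
  inner g (F s t) (X s t) (Y s t).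

Definition gram_det (s t : R) : R :=
  first_form (d1 F) (d1 F) s t * first_form (d2 F) (d2 F) s t
  - first_form (d1 F) (d2 F) s t ^ 2.

Definition area_element (s t : R) : R := sqrt (gram_det s t).

(* The Euclidean cross product of the coordinate tangent vectors is read as a
   covector: it annihilates the tangent plane whatever the metric is, and its
   index is then raised with g. *)
Definition normal (s t : R) : vec :=
  fun k => sum3 (fun l => inv3 (g (F s t)) k l * cross (d1 F s t) (d2 F s t) l).

Definition unit_normal (s t : R) : vec :=
  fun k => normal s t k
           / sqrt (inner g (F s t) (normal s t) (normal s t)).

(* For X = dF/dp, Y = dF/dq and Z = d^2F/dp dq, the covariant derivative of Y
   along X. *)
Definition covariant (X Y Z : surface) (s t : R) : vec :=
  fun k => Z s t k
    + sum3 (fun p => sum3 (fun q =>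
        christoffel g k p q (F s t) * X s t p * Y s t q)).

Definition second_form (X Y Z : surface) (s t : R) : R :=
  inner g (F s t) (covariant X Y Z s t) (unit_normal s t).

(* Trace of the second fundamental form with respect to the first one, the
   2x2 inverse being written out. *)
Definition mean_curvature (s t : R) : R :=
  (first_form (d2 F) (d2 F) s t * second_form (d1 F) (d1 F) (d1 (d1 F)) s t
   - 2 * first_form (d1 F) (d2 F) s t
       * second_form (d1 F) (d2 F) (d1 (d2 F)) s t
   + first_form (d1 F) (d1 F) s t * second_form (d2 F) (d2 F) (d2 (d2 F)) s t)
  / gram_det s t.

(* The parameter domain is that of spherical coordinates, 0 < s < pi and
   0 < t < 2 pi; it misses only a null set of the surface. *)
Definition surface_integral (h : R -> R -> R) : R :=
  RInt (fun s => RInt (fun t => h s t * area_element s t) 0 (2 * PI)) 0 PI.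

Definition area : R := surface_integral (fun _ _ => 1).

Definition hawking_mass (Lambda : R) : R :=
  sqrt (area / (16 * PI)) *
  (1 - / (16 * PI) * surface_integral (fun s t => mean_curvature s t ^ 2)
     - Lambda / (24 * PI) * area).

End Surface.

(** * The deSitter-Schwarzschild manifold R x S^2 *)

Record deSitter_profile (a : R) (u : R -> R) : Prop := {
  profile_pos : forall r, 0 < u r;
  profile_derivable : forall r, ex_derive u r;
  profile_derivable2 : forall r, ex_derive (Derive u) r;
  profile_ode : forall r,
    Derive (Derive u) r = / 2 * ((1 - Derive u r ^ 2) / u r) - u r / 2;
  profile_init : u 0 = a;
  profile_init' : Derive u 0 = 0;
  profile_min : forall r, a <= u r }.

Definition S2 (x : vec) : Prop := dot x x = 1.

Definition spherical (s t : R) : vec :=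
  mkvec (sin s * cos t) (sin s * sin t) (cos s).

(* Points of R x S^2 are pairs (r, x) with x in S^2; (r, s, t) are the
   coordinates of (r, spherical s t), with 0 < s < pi. *)
Definition chart (y : vec) : R * vec := (y i0, spherical (y i1) (y i2)).

Definition chart_domain (y : vec) : Prop := 0 < y i1 < PI.

(* dr^2 + u(r)^2 (ds^2 + sin(s)^2 dt^2) *)
Definition dss_metric (u : R -> R) : metric := fun y i j =>
  match i, j with
  | i0, i0 => 1
  | i1, i1 => u (y i0) ^ 2
  | i2, i2 => u (y i0) ^ 2 * sin (y i1) ^ 2
  | _, _ => 0
  end.

(* The chart omits {x = north or south pole}, which is nowhere dense, so by
   continuity the infimum over the chart is the infimum over the manifold. *)
Definition dss_Lambda (u : R -> R) : R :=
  inf_scalar_curvature (dss_metric u) chart_domain.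

Definition slice (r : R) (p : R * vec) : Prop := S2 (snd p) /\ fst p = r.

Definition normal_graph (r : R) (phi : vec -> R) (p : R * vec) : Prop :=
  S2 (snd p) /\ fst p = r + phi (snd p).

Definition graph_surface (r : R) (phi : vec -> R) : surface :=
  fun s t => mkvec (r + phi (spherical s t)) s t.

(* [graph_surface] is the spherical parametrization of the normal graph, read in
   the chart. *)
Lemma graph_surface_in_graph (r : R) (phi : vec -> R) (s t : R) :
  normal_graph r phi (chart (graph_surface r phi s t)).
Proof.
  split; [ | reflexivity].
  unfold S2, dot, sum3; simpl.
  generalize (sin2_cos2 s) (sin2_cos2 t); unfold Rsqr; intros Hs Ht.
  transitivity (sin s * sin s * (sin t * sin t + cos t * cos t)
                + cos s * cos s); [ring | now rewrite Ht, Rmult_1_r].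
Qed.

Definition dss_hawking_mass_graph (u : R -> R) (r : R) (phi : vec -> R) : R :=
  hawking_mass (dss_metric u) (graph_surface r phi) (dss_Lambda u).

Definition dss_hawking_mass_slice (u : R -> R) (r : R) : R :=
  dss_hawking_mass_graph u r (fun _ => 0).

(** ** C^2 functions on S^2 *)

(* A function on S^2 is represented by [phi : vec -> R], of which only the
   values on S^2 matter; [hext phi] is its 0-homogeneous extension to
   R^3 \ {0}, which is C^2 there iff phi is C^2 on S^2. *)
Definition hext (phi : vec -> R) (x : vec) : R :=
  phi (fun i => x i / enorm x).

Definition C2_sphere (phi : vec -> R) : Prop :=
  forall x : vec, dot x x <> 0 -> forall i j : ix,
    ex_partial i (hext phi) x /\
    continuous (partial i (hext phi)) x /\
    ex_partial j (partial i (hext phi)) x /\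
    continuous (partial j (partial i (hext phi))) x.

(* At a point of S^2 the Euclidean gradient of the 0-homogeneous extension is
   the gradient for the round metric, and the tangential part of its Euclidean
   Hessian is the covariant Hessian for the round metric. *)
Definition sphere_grad (phi : vec -> R) (x : vec) : vec :=
  fun i => partial i (hext phi) x.

Definition tangent_proj (x : vec) : mat :=
  fun i j => (if ix_eqb i j then 1 else 0) - x i * x j.

Definition sphere_hess (phi : vec -> R) (x : vec) : mat :=
  fun i j => sum3 (fun k => sum3 (fun l =>
    tangent_proj x i k * partial k (partial l (hext phi)) x
    * tangent_proj x l j)).

Definition mat_norm (A : mat) : R :=
  sqrt (sum3 (fun i => sum3 (fun j => A i j ^ 2))).

Definition sup_S2 (f : vec -> R) : Rbar :=
  Lub_Rbar (fun y => exists x, S2 x /\ y = f x).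

(* The C^2 norm for the metric rho^2 g_{S^2}, whose Levi-Civita connection is
   that of g_{S^2}; the slice over r is the case rho = u r. *)
Definition C2_norm (rho : R) (phi : vec -> R) : Rbar :=
  Rbar_plus (sup_S2 (fun x => Rabs (phi x)))
    (Rbar_plus (sup_S2 (fun x => enorm (sphere_grad phi x) / rho))
               (sup_S2 (fun x => mat_norm (sphere_hess phi x) / rho ^ 2))).

(* Main.v *)
From Stdlib Require Import Reals Lra Psatz FunctionalExtensionality.
From Coquelicot Require Import Coquelicot.
(* Imported last: Stdlib's Reals also exports the names [d1] and [d2]. *)
Require Import Defs.
Open Scope R_scope.

(* Write f = r + phi, v = u(f), q = |grad f|^2 and S = sqrt(v^2 + q), gradients and
   averages < . > being taken on the unit round sphere.  The graph has area element v S
   and mean curvature D / v - 2 u'(f) / S up to sign, where D = div (grad f / S).  With the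
   first integral u'^2 = 1 - 2 m / u - u^2 / 3 and an integration by parts of u'(f) D, its
   Hawking mass becomes
     sqrt <v S> / 2 * (1 - <S D^2 / v + 4 v / S> / 4 + 2 m <(2 v^2 - q) / (2 v^2 S)>),
   which is m on every slice.
   The curvature term is controlled through D^2 >= 2 p D - p^2 with p = - 2 (f - <f>) / u(r):
   after an integration by parts the Poincare inequality 2 Var f <= <q> shows that
   <S D^2 / v + 4 v / S> >= 4 up to an error that is a small multiple of <q>.
   Expanding the other factors to second order at the mean of v leaves
     m_H / m <= 1 + (3/2) Var(v) / u(r)^2 - (3/4) <q> / u(r)^2 + small * <q>,
   and Var v <= <u'(f)^2 q> / 2 by Poincare again.  Since u'^2 < 1 this is less than 1
   unless q = 0 identically, in which case f is constant. *)

(** The choice of [p] is forced by a cancellation at leading order. Pointwise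
    [4 v / S >= 4 - 2 q / v^2], a loss of about [2 <q> / u(r)^2], so the nonnegative term in [D^2]
    cannot be discarded. Near the slice D is the Laplacian of f divided by u(r), and on first
    spherical harmonics that is exactly p. With this p the term [2 p D] yields about
    [4 <q> / u(r)^2] while [p^2] costs at most [2 <q> / u(r)^2], which just repays the loss. A
    Poincare constant below 2 would leave an error comparable to <q>, so the sharp one is proved, by
    one-variable inequalities along parallels and meridians. Write V = Var(v) / u(r)^2 and P = <q> /
    u(r)^2. The square root contributes [V / 2 + P / 4] and the factor of 2 m contributes [V - P],
    whence 3/2 and 3/4. The strict bound u'^2 < 1 comes from m > 0, hence from 0 < a < 1. Spherical
    coordinates degenerate at the poles. Gradient and Hessian are therefore carried by their
    components in the orthonormal frame, continuous in (s, t) everywhere, and the weight sin s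
    removes the boundary terms. *)

Definition C1D (f : R -> R) : Prop := forall x, continuous f x.
(** The digit in [C1D] and [C2D] counts variables, not derivatives: both mean plain continuity, on
    the whole line or plane. *)
Definition C2D (g : R -> R -> R) : Prop := forall s t, continuity_2d_pt g s t.

Lemma C2D_const (c : R) : C2D (fun _ _ => c).
Proof. intros s t; apply continuity_2d_pt_const. Qed.

Lemma C2D_fst : C2D (fun s _ => s).
Proof. intros s t; apply continuity_2d_pt_id1. Qed.

Lemma C2D_snd : C2D (fun _ t => t).
Proof. intros s t; apply continuity_2d_pt_id2. Qed.

Lemma C2D_plus f g : C2D f -> C2D g -> C2D (fun s t => f s t + g s t).
Proof. intros Hf Hg s t; now apply continuity_2d_pt_plus. Qed.

Lemma C2D_minus f g : C2D f -> C2D g -> C2D (fun s t => f s t - g s t).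
Proof. intros Hf Hg s t; now apply continuity_2d_pt_minus. Qed.

Lemma C2D_opp f : C2D f -> C2D (fun s t => - f s t).
Proof. intros Hf s t; now apply continuity_2d_pt_opp. Qed.

Lemma C2D_mult f g : C2D f -> C2D g -> C2D (fun s t => f s t * g s t).
Proof. intros Hf Hg s t; now apply continuity_2d_pt_mult. Qed.

Lemma C2D_pow f n : C2D f -> C2D (fun s t => f s t ^ n).
Proof.
  intros Hf; induction n as [|n IH]; simpl; [apply C2D_const | now apply C2D_mult].
Qed.

Lemma C2D_inv f : C2D f -> (forall s t, f s t <> 0) -> C2D (fun s t => / f s t).
Proof. intros Hf Hn s t; now apply continuity_2d_pt_inv. Qed.

Lemma C2D_div f g :
  C2D f -> C2D g -> (forall s t, g s t <> 0) -> C2D (fun s t => f s t / g s t).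
Proof. intros Hf Hg Hn; apply C2D_mult; [assumption | now apply C2D_inv]. Qed.

Lemma C2D_comp h g : C1D h -> C2D g -> C2D (fun s t => h (g s t)).
Proof.
  intros Hh Hg s t; apply continuity_1d_2d_pt_comp; [| apply Hg].
  apply continuity_pt_filterlim, Hh.
Qed.

Lemma C1D_of_C2D f : C2D (fun _ t => f t) -> C1D f.
Proof.
  intros H t; apply continuity_pt_filterlim.
  intros e He; destruct (H 0 t (mkposreal e He)) as [d Hd].
  exists d; split; [apply cond_pos |].
  intros y [_ Hy]; apply (Hd 0 y); [rewrite Rminus_eq_0, Rabs_R0; apply cond_pos | exact Hy].
Qed.

Lemma C2D_section f : C2D f -> forall s, C1D (f s).
Proof.
  intros H s t; apply continuity_pt_filterlim.
  intros e He; destruct (H s t (mkposreal e He)) as [d Hd].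
  exists d; split; [apply cond_pos |].
  intros y [_ Hy]; apply (Hd s y); [rewrite Rminus_eq_0, Rabs_R0; apply cond_pos | exact Hy].
Qed.

Lemma C1D_sin : C1D sin.
Proof. intros x; apply continuous_sin. Qed.

Lemma C1D_cos : C1D cos.
Proof. intros x; apply continuous_cos. Qed.

Lemma C1D_sqrt : C1D sqrt.
Proof. intros x; apply continuous_sqrt. Qed.

Lemma C1D_derive f df : (forall x, is_derive f x (df x)) -> C1D f.
Proof.
  intros H x; apply (ex_derive_continuous (K := R_AbsRing) (V := R_NormedModule)).
  exists (df x); apply H.
Qed.

(** Syntax-directed continuity. One-variable goals are lifted to two variables so that a single set
    of rules serves both; a denominator's non-vanishing is taken from the context or left to the
    caller. *)
Ltac c2d :=
  repeat first
  [ assumption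
  | apply C1D_sin | apply C1D_cos | apply C1D_sqrt
  | lazymatch goal with
    | |- C1D (fun _ => _) => apply C1D_of_C2D; cbv beta
    | |- C2D (fun _ _ => ?c) => apply (C2D_const c)
    | |- C2D (fun s t => @?A s t + @?B s t) => apply (C2D_plus A B)
    | |- C2D (fun s t => @?A s t - @?B s t) => apply (C2D_minus A B)
    | |- C2D (fun s t => @?A s t * @?B s t) => apply (C2D_mult A B)
    | |- C2D (fun s t => @?A s t / @?B s t) => apply (C2D_div A B)
    | |- C2D (fun s t => - @?A s t) => apply (C2D_opp A)
    | |- C2D (fun s t => / @?A s t) => apply (C2D_inv A)
    | |- C2D (fun s t => @?A s t ^ ?n) => apply (C2D_pow A n)
    | |- C2D (fun s _ => s) => apply C2D_fst
    | |- C2D (fun _ t => t) => apply C2D_snd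
    | |- C2D (fun s t => ?h (@?A s t)) => apply (C2D_comp h A)
    end ].

Ltac dsub :=
  repeat match goal with
  | |- context [Derive ?g ?x] => erewrite (is_derive_unique g x) by (solve [eauto])
  end.

Lemma C1D_ex_RInt f a b : C1D f -> ex_RInt f a b.
Proof. intros H; apply (ex_RInt_continuous (V := R_CompleteNormedModule)); auto. Qed.

Lemma RInt_real_ext (f g : R -> R) a b :
  (forall x, Rmin a b < x < Rmax a b -> f x = g x) -> RInt f a b = RInt g a b.
Proof. apply (RInt_ext (V := R_CompleteNormedModule)). Qed.

Lemma RInt_split f a b c : C1D f -> RInt f a b + RInt f b c = RInt f a c.
Proof. intros H; apply (RInt_Chasles (V := R_CompleteNormedModule)); now apply C1D_ex_RInt. Qed.

Lemma RInt_C1D_plus f g a b : C1D f -> C1D g ->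
  RInt (fun x => f x + g x) a b = RInt f a b + RInt g a b.
Proof. intros; apply (RInt_plus (V := R_CompleteNormedModule)); now apply C1D_ex_RInt. Qed.

Lemma RInt_C1D_minus f g a b : C1D f -> C1D g ->
  RInt (fun x => f x - g x) a b = RInt f a b - RInt g a b.
Proof. intros; apply (RInt_minus (V := R_CompleteNormedModule)); now apply C1D_ex_RInt. Qed.

Lemma RInt_C1D_scal c f a b : C1D f -> RInt (fun x => c * f x) a b = c * RInt f a b.
Proof. intros; apply (RInt_scal (V := R_CompleteNormedModule)); now apply C1D_ex_RInt. Qed.

(** * Integrals over a full period *)

Definition circ (f : R -> R) : R := RInt f 0 (2 * PI).

Lemma circ_ext f g : (forall t, f t = g t) -> circ f = circ g.
Proof. intros H; apply RInt_ext; intros; apply H. Qed.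

Lemma circ_plus f g : C1D f -> C1D g -> circ (fun t => f t + g t) = circ f + circ g.
Proof. intros Hf Hg; apply (RInt_plus (V := R_CompleteNormedModule) f g); now apply C1D_ex_RInt. Qed.

Lemma circ_scal c f : C1D f -> circ (fun t => c * f t) = c * circ f.
Proof. intros Hf; apply (RInt_scal (V := R_CompleteNormedModule) f); now apply C1D_ex_RInt. Qed.

Lemma circ_const c : circ (fun _ => c) = 2 * PI * c.
Proof. unfold circ; rewrite RInt_const; unfold scal; simpl; unfold mult; simpl; ring. Qed.

Lemma circ_le f g : C1D f -> C1D g -> (forall t, f t <= g t) -> circ f <= circ g.
Proof.
  intros Hf Hg H; apply RInt_le; try now apply C1D_ex_RInt.
  - generalize PI_RGT_0; lra.
  - intros; apply H.
Qed.

Lemma circ_C1D g : C2D g -> C1D (fun s => circ (g s)).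
Proof.
  intros Hg s; apply continuity_pt_filterlim.
  intros e He; pose proof PI_RGT_0 as Hpi.
  (* Over an interval of length [2 * PI] this tolerance integrates to [e / 2], leaving room for a
     strict inequality. *)
  assert (He' : 0 < e / (4 * PI)) by (apply Rdiv_lt_0_compat; lra).
  destruct (uniform_continuity_2d_1d' g 0 (2 * PI) s (fun x _ => Hg s x)
              (mkposreal _ He')) as [d Hd].
  exists d; split; [apply cond_pos |].
  intros y [_ Hy]; simpl in *; unfold Rdist in *.
  assert (Hc : forall x, C1D (g x)) by (intros; now apply C2D_section).
  unfold circ.
  replace (RInt (g y) 0 (2 * PI) - RInt (g s) 0 (2 * PI))
    with (RInt (fun t => g y t - g s t) 0 (2 * PI)).
  2:{ apply (RInt_minus (V := R_CompleteNormedModule) (g y) (g s)); now apply C1D_ex_RInt. }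
  apply Rle_lt_trans with ((2 * PI - 0) * (e / (4 * PI))).
  - apply abs_RInt_le_const; [lra | |].
    + apply C1D_ex_RInt; intros t.
      apply (continuous_minus (V := R_NormedModule) (g y) (g s)); apply Hc.
    + intros t Ht. left. apply (Hd t s t y); try lra.
      * split; apply Rabs_def2 in Hy; generalize (cond_pos d); lra.
      * split; apply Rabs_def2 in Hy; generalize (cond_pos d); lra.
      * rewrite Rminus_eq_0, Rabs_R0; apply cond_pos.
  - replace ((2 * PI - 0) * (e / (4 * PI))) with (e / 2) by (field; lra). lra.
Qed.

Lemma circ_derive g dg :
  (forall s t, is_derive (fun z => g z t) s (dg s t)) -> C2D dg ->
  (forall s, C1D (g s)) ->
  forall s, is_derive (fun z => circ (g z)) s (circ (dg s)).
Proof.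
  intros Hd Hc Hg s.
  replace (circ (dg s)) with (RInt (fun t => Derive (fun z => g z t) s) 0 (2 * PI)).
  2:{ apply RInt_ext; intros t _; apply is_derive_unique, Hd. }
  apply (is_derive_RInt_param g).
  - apply filter_forall; intros x t _; exists (dg x t); apply Hd.
  - intros t _. apply continuity_2d_pt_ext with dg; [| apply Hc].
    intros x y; symmetry; apply is_derive_unique, Hd.
  - apply filter_forall; intros y; now apply C1D_ex_RInt.
Qed.

(** * Integrals over the sphere *)

(** The area weight [sin s] stays in the integrand, so that weighted divergences are plain sums of
    partial derivatives. *)
Definition sint (g : R -> R -> R) : R := RInt (fun s => circ (g s)) 0 PI.

Lemma sint_ext f g :
  (forall s t, 0 < s < PI -> f s t = g s t) -> sint f = sint g.
Proof.
  intros H; apply RInt_ext; intros s Hs; apply circ_ext; intros t; apply H.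
  generalize PI_RGT_0; intros; rewrite Rmin_left, Rmax_right in Hs; lra.
Qed.

Lemma sint_plus f g : C2D f -> C2D g -> sint (fun s t => f s t + g s t) = sint f + sint g.
Proof.
  intros Hf Hg. unfold sint.
  transitivity (RInt (fun s => circ (f s) + circ (g s)) 0 PI).
  - apply RInt_ext; intros s _; apply circ_plus; now apply C2D_section.
  - apply (RInt_plus (V := R_CompleteNormedModule)); now apply C1D_ex_RInt, circ_C1D.
Qed.

Lemma sint_scal c f : C2D f -> sint (fun s t => c * f s t) = c * sint f.
Proof.
  intros Hf. unfold sint.
  transitivity (RInt (fun s => c * circ (f s)) 0 PI).
  - apply RInt_ext; intros s _; apply circ_scal; now apply C2D_section.
  - apply (RInt_scal (V := R_CompleteNormedModule)); now apply C1D_ex_RInt, circ_C1D.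
Qed.

Lemma sint_minus f g : C2D f -> C2D g -> sint (fun s t => f s t - g s t) = sint f - sint g.
Proof.
  intros Hf Hg.
  transitivity (sint (fun s t => f s t + (-1) * g s t)).
  - apply sint_ext; intros; ring.
  - rewrite sint_plus, sint_scal by c2d; ring.
Qed.

Lemma sint_le f g : C2D f -> C2D g ->
  (forall s t, 0 < s < PI -> f s t <= g s t) -> sint f <= sint g.
Proof.
  intros Hf Hg H; pose proof PI_RGT_0; apply RInt_le; try lra.
  1,2: now apply C1D_ex_RInt, circ_C1D.
  intros s Hs; apply circ_le; try now apply C2D_section.
  intros t; now apply H.
Qed.

Lemma sint_sin : sint (fun s _ => sin s) = 4 * PI.
Proof.
  unfold sint.
  transitivity (RInt (fun s => 2 * PI * sin s) 0 PI).
  - apply RInt_ext; intros s _; apply circ_const.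
  - replace (4 * PI) with (minus (- (2 * PI) * cos PI) (- (2 * PI) * cos 0)).
    2:{ rewrite cos_PI, cos_0; unfold minus, plus, opp; simpl; ring. }
    apply (is_RInt_unique (V := R_CompleteNormedModule)).
    apply (is_RInt_derive (V := R_CompleteNormedModule) (fun s => - (2 * PI) * cos s)).
    + intros x _; auto_derive; [easy | ring].
    + intros x _.
      apply (ex_derive_continuous (K := R_AbsRing) (V := R_NormedModule)).
      auto_derive; easy.
Qed.

(* Only interior differentiability is required, so that T may be the continuous
   extension of a quotient that is singular at the end points. *)
Lemma RInt_ge_increment (T dT J : R -> R) (a b : R) :
  a <= b ->
  (forall x, a < x < b -> is_derive T x (dT x)) ->
  (forall x, a <= x <= b -> continuous T x) ->
  C1D J -> (forall x, a < x < b -> dT x <= J x) ->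
  T b - T a <= RInt J a b.
Proof.
  intros Hab HT HTc HJ Hle.
  set (P := fun x => RInt J a x - T x).
  assert (HRI : forall x, is_derive (fun x => RInt J a x) x (J x)).
  { intros x. apply (is_derive_RInt (V := R_NormedModule) J (fun x => RInt J a x) a x); [| apply HJ].
    apply filter_forall; intros y; apply (RInt_correct (V := R_CompleteNormedModule)).
    now apply C1D_ex_RInt. }
  (* The mean value theorem may return an end point, where [dT] is not controlled; the value 0 there
     keeps the sign. *)
  set (df := fun x => if Rlt_dec a x then if Rlt_dec x b then J x - dT x else 0 else 0).
  destruct (MVT_gen P a b df) as [c [Hc Heq]].
  - rewrite Rmin_left, Rmax_right by lra. intros x Hx. unfold df.
    destruct (Rlt_dec a x); [destruct (Rlt_dec x b) |]; try lra.
    apply (is_derive_minus (K := R_AbsRing) (V := R_NormedModule) (fun x => RInt J a x) T x).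
    + apply HRI.
    + now apply HT.
  - rewrite Rmin_left, Rmax_right by lra. intros x Hx.
    apply continuity_pt_filterlim.
    apply (continuous_minus (V := R_NormedModule) (fun x => RInt J a x) T x).
    + apply (ex_derive_continuous (K := R_AbsRing) (V := R_NormedModule)).
      eexists; apply HRI.
    + now apply HTc.
  - assert (0 <= df c).
    { unfold df; destruct (Rlt_dec a c); [destruct (Rlt_dec c b) |]; try lra.
      generalize (Hle c ltac:(lra)); lra. }
    assert (0 <= df c * (b - a)) by (apply Rmult_le_pos; lra).
    assert (HPa : P a = - T a).
    { unfold P. rewrite RInt_point. unfold zero; simpl; ring. }
    unfold P in Heq at 1; rewrite HPa in Heq. lra.
Qed.

(** * The Poincare inequality on the sphere *)

(* Jacobi's trick with the ground state cos (l (x - a - PI / 2)), positive on the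
   closed interval since l < 1; then l tends to 1. *)
Lemma wirtinger_dirichlet (k dk : R -> R) (a : R) :
  (forall x, is_derive k x (dk x)) -> C1D dk -> k a = 0 -> k (a + PI) = 0 ->
  RInt (fun x => k x ^ 2) a (a + PI) <= RInt (fun x => dk x ^ 2) a (a + PI).
Proof.
  intros Hk Hdk Ha Hb; pose proof PI_RGT_0 as Hpi.
  assert (Ck : C1D k) by (eapply C1D_derive; eauto).
  set (X := RInt (fun x => k x ^ 2) a (a + PI)).
  set (Y := RInt (fun x => dk x ^ 2) a (a + PI)).
  assert (HX : 0 <= X).
  { apply RInt_ge_0; [lra | apply C1D_ex_RInt; c2d | intros; apply pow2_ge_0]. }
  assert (HY : 0 <= Y).
  { apply RInt_ge_0; [lra | apply C1D_ex_RInt; c2d | intros; apply pow2_ge_0]. }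
  assert (Hl : forall l, 0 < l < 1 -> l ^ 2 * X <= Y).
  { intros l Hl.
    assert (Hcos : forall x, a <= x <= a + PI -> 0 < cos (l * (x - a - PI / 2))).
    { intros x Hx; apply cos_gt_0.
      - assert (l * (PI / 2 - (x - a)) <= l * (PI / 2)) by (apply Rmult_le_compat_l; lra).
        assert (l * (PI / 2) < 1 * (PI / 2)) by (apply Rmult_lt_compat_r; lra). lra.
      - assert (l * ((x - a) - PI / 2) <= l * (PI / 2)) by (apply Rmult_le_compat_l; lra).
        assert (l * (PI / 2) < 1 * (PI / 2)) by (apply Rmult_lt_compat_r; lra). lra. }
    set (th := fun x => sin (l * (x - a - PI / 2)) / cos (l * (x - a - PI / 2))).
    (* Chosen so that [dk ^ 2 - l ^ 2 * k ^ 2 - dT = (dk + l * th * k) ^ 2]; [T] vanishes at both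
       ends together with [k]. *)
    set (T := fun x => - l * th x * k x ^ 2).
    set (dT := fun x => - l * (l * (1 + th x ^ 2) * k x ^ 2 + 2 * th x * k x * dk x)).
    assert (HT : forall x, a <= x <= a + PI -> is_derive T x (dT x)).
    { intros x Hx; unfold T, dT, th. specialize (Hcos x Hx).
      auto_derive.
      - repeat split; try (eexists; apply Hk); try lra; now apply Rgt_not_eq.
      - dsub.
        unfold Rminus; field; now apply Rgt_not_eq. }
    assert (H : T (a + PI) - T a <= RInt (fun x => dk x ^ 2 - l ^ 2 * k x ^ 2) a (a + PI)).
    { apply RInt_ge_increment with dT; try lra.
      - intros x Hx; apply HT; lra.
      - intros x Hx; apply (ex_derive_continuous (K := R_AbsRing) (V := R_NormedModule)).
        exists (dT x); now apply HT.
      - c2d.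
      - intros x Hx; unfold dT.
        generalize (pow2_ge_0 (dk x + l * th x * k x)); nra. }
    unfold T in H; rewrite Ha, Hb in H.
    assert (E : RInt (fun x => dk x ^ 2 - l ^ 2 * k x ^ 2) a (a + PI) = Y - l ^ 2 * X).
    { unfold X, Y.
      rewrite RInt_C1D_minus, RInt_C1D_scal by c2d; reflexivity. }
    rewrite E in H; lra. }
  destruct (Rle_lt_dec X Y) as [|Hlt]; [assumption | exfalso].
  (* With [l = 1 - e] one gets [l ^ 2 * X >= X - 2 * e * X = (X + Y) / 2 > Y]. *)
  set (e := (X - Y) / (4 * X)).
  assert (He : e * X = (X - Y) / 4) by (unfold e; field; lra).
  assert (0 < e) by (apply Rdiv_lt_0_compat; lra).
  assert (e < 1) by (apply Rmult_lt_reg_r with X; lra).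
  specialize (Hl (1 - e) ltac:(lra)). nra.
Qed.

Lemma circ_shift f a : C1D f -> (forall x, f (x + 2 * PI) = f x) ->
  RInt f a (a + 2 * PI) = circ f.
Proof.
  intros Hc Hp; unfold circ.
  assert (E : RInt f 0 a = RInt f (2 * PI) (a + 2 * PI)).
  { transitivity (RInt (fun y => scal 1 (f (1 * y + 2 * PI))) 0 a).
    - apply RInt_ext; intros x _. change (f x = 1 * f (1 * x + 2 * PI)).
      now rewrite !Rmult_1_l, Hp.
    - rewrite (RInt_comp_lin (V := R_CompleteNormedModule)); [| now apply C1D_ex_RInt].
      f_equal; ring. }
  generalize (RInt_split f 0 a (a + 2 * PI) Hc) (RInt_split f 0 (2 * PI) (a + 2 * PI) Hc).
  lra.
Qed.

(* By the intermediate value theorem k takes the same value c at two antipodal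
   points, so that k - c satisfies Dirichlet conditions on two half circles. *)
Lemma wirtinger (k dk : R -> R) :
  (forall x, is_derive k x (dk x)) -> C1D dk ->
  (forall x, k (x + 2 * PI) = k x) -> (forall x, dk (x + 2 * PI) = dk x) ->
  circ k = 0 -> circ (fun x => k x ^ 2) <= circ (fun x => dk x ^ 2).
Proof.
  intros Hk Hdk Hp Hdp Hm; pose proof PI_RGT_0 as Hpi.
  assert (Ck : C1D k) by (eapply C1D_derive; eauto).
  assert (Ht : exists t0, k (t0 + PI) = k t0).
  { destruct (IVT_gen (fun x => k (x + PI) - k x) 0 PI 0) as [t0 [_ Ht0]].
    - assert (Cd : C1D (fun x => k (x + PI) - k x)) by c2d.
      intros x; apply continuity_pt_filterlim, Cd.
    - replace (PI + PI) with (0 + 2 * PI) by ring. rewrite Hp, Rplus_0_l.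
      unfold Rmin, Rmax; destruct (Rle_dec _ _); lra.
    - exists t0; lra. }
  destruct Ht as [t0 Ht0]. set (c := k t0) in *.
  assert (Hkc : forall x, is_derive (fun x => k x - c) x (dk x)).
  { intros x; auto_derive; [eexists; apply Hk |].
    dsub; ring. }
  assert (H1 := wirtinger_dirichlet (fun x => k x - c) dk t0 Hkc Hdk).
  assert (H2 := wirtinger_dirichlet (fun x => k x - c) dk (t0 + PI) Hkc Hdk).
  cbv beta in H1, H2. fold c in H1.
  replace (t0 + PI + PI) with (t0 + 2 * PI) in H2 by ring. rewrite Hp in H2.
  fold c in H2. rewrite Ht0 in H1, H2.
  specialize (H1 ltac:(lra) ltac:(lra)); specialize (H2 ltac:(lra) ltac:(lra)).
  assert (C1 : C1D (fun x => (k x - c) ^ 2)) by c2d.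
  assert (C2 : C1D (fun x => dk x ^ 2)) by c2d.
  assert (S1 : RInt (fun x => (k x - c) ^ 2) t0 (t0 + 2 * PI) = circ (fun x => (k x - c) ^ 2)).
  { apply circ_shift; [assumption | intros; cbv beta; now rewrite Hp]. }
  assert (S2 : RInt (fun x => dk x ^ 2) t0 (t0 + 2 * PI) = circ (fun x => dk x ^ 2)).
  { apply circ_shift; [assumption | intros; cbv beta; now rewrite Hdp]. }
  rewrite <- (RInt_split _ t0 (t0 + PI)) in S1 by assumption.
  rewrite <- (RInt_split _ t0 (t0 + PI)) in S2 by assumption.
  (* Since [k] has mean zero, subtracting [c] can only increase the left-hand side. *)
  assert (E : circ (fun x => (k x - c) ^ 2) = circ (fun x => k x ^ 2) + 2 * PI * c ^ 2).
  { transitivity (circ (fun x => k x ^ 2 + (- 2 * c * k x + c ^ 2))).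
    - apply circ_ext; intros; ring.
    - rewrite circ_plus, circ_plus, circ_scal, circ_const, Hm by c2d. ring. }
  assert (0 <= c ^ 2) by apply pow2_ge_0.
  assert (0 <= 2 * PI * c ^ 2) by (apply Rmult_le_pos; lra).
  lra.
Qed.

(** On the circle at colatitude [s], Wirtinger bounds the integral of [e2 ^ 2] below by that of
    [e ^ 2 / sin s ^ 2]. What remains is, up to the derivative of [cos s * K s], the square
    [sin s * (e1 - cos s / sin s * e) ^ 2]. It vanishes on the first harmonics [sin s * cos t] and
    [sin s * sin t], so nothing is lost in the constant 2. *)
Lemma poincare_mean_zero_circles (e e1 e2 : R -> R -> R) :
  (forall s t, is_derive (fun z => e z t) s (e1 s t)) ->
  (forall s t, is_derive (fun z => e s z) t (sin s * e2 s t)) ->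
  C2D e -> C2D e1 -> C2D e2 ->
  (forall s t, e s (t + 2 * PI) = e s t) -> (forall s t, e2 s (t + 2 * PI) = e2 s t) ->
  (forall s, circ (e s) = 0) ->
  2 * sint (fun s t => sin s * e s t ^ 2)
  <= sint (fun s t => sin s * (e1 s t ^ 2 + e2 s t ^ 2)).
Proof.
  intros Hs Ht Ce Ce1 Ce2 Pe Pe2 H0; pose proof PI_RGT_0 as Hpi.
  set (K := fun s => circ (fun t => e s t ^ 2)).
  set (dK := fun s => circ (fun t => 2 * e s t * e1 s t)).
  assert (Sec : forall g s, C2D g -> C1D (g s)) by (intros; now apply C2D_section).
  assert (HK : forall s, is_derive K s (dK s)).
  { intros s. apply (circ_derive (fun s t => e s t ^ 2) (fun s t => 2 * e s t * e1 s t)).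
    - intros x t; auto_derive; [eexists; apply Hs | dsub; ring].
    - c2d.
    - intros x; apply (Sec (fun s t => e s t ^ 2)); c2d. }
  (* At a pole the [t]-derivative [sin s * e2 s t] is 0, so [e s] is constant, and its zero mean
     makes the constant 0: the boundary terms of [cos s * K s] drop out. *)
  assert (Hpole : forall s, sin s = 0 -> K s = 0).
  { intros s Hsin.
    assert (Hc : forall t, e s t = e s 0).
    { intros t; destruct (MVT_gen (e s) 0 t (fun t => sin s * e2 s t)) as [c [_ E]].
      - intros; apply Ht.
      - intros; apply continuity_pt_filterlim, (C2D_section e Ce s).
      - rewrite Hsin, !Rmult_0_l in E; lra. }
    assert (Hz : e s 0 = 0).
    { generalize (H0 s). rewrite (circ_ext _ (fun _ => e s 0)), circ_const by apply Hc.
      intros E; apply Rmult_integral in E; destruct E; [lra | assumption]. }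
    unfold K; rewrite (circ_ext _ (fun _ => 0)), circ_const; [ring |].
    intros t; rewrite Hc, Hz; ring. }
  set (J := fun s t => sin s * (e1 s t ^ 2 + e2 s t ^ 2) - 2 * (sin s * e s t ^ 2)).
  assert (CJ : C2D J) by (unfold J; c2d).
  assert (HT : cos PI * K PI - cos 0 * K 0 <= sint J).
  { apply (RInt_ge_increment (fun s => cos s * K s)
             (fun s => - sin s * K s + cos s * dK s)); try lra.
    - intros s _; auto_derive; [eexists; apply HK | dsub; ring].
    - intros s _. apply (continuous_mult (K := R_AbsRing) cos K); [apply C1D_cos |].
      apply (C1D_derive _ _ HK).
    - now apply circ_C1D.
    - intros s Hsp. assert (Hsin : 0 < sin s) by (apply sin_gt_0; lra).
      assert (W : circ (fun t => e s t ^ 2) <= circ (fun t => (sin s * e2 s t) ^ 2)).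
      { apply wirtinger; auto.
        - apply (Sec (fun s t => sin s * e2 s t)); c2d.
        - intros x; now rewrite Pe2. }
      fold (K s) in W.
      assert (E2 : circ (fun t => (sin s * e2 s t) ^ 2) = sin s ^ 2 * circ (fun t => e2 s t ^ 2)).
      { rewrite <- circ_scal by (apply (Sec (fun s t => e2 s t ^ 2)); c2d).
        apply circ_ext; intros; ring. }
      rewrite E2 in W.
      assert (EJ : circ (J s) = circ (fun t => sin s * e1 s t ^ 2 - 2 * sin s * e s t ^ 2)
                               + sin s * circ (fun t => e2 s t ^ 2)).
      { rewrite <- circ_scal by (apply (Sec (fun s t => e2 s t ^ 2)); c2d).
        rewrite <- circ_plus.
        - apply circ_ext; intros; unfold J; ring.
        - apply (Sec (fun s t => sin s * e1 s t ^ 2 - 2 * sin s * e s t ^ 2)); c2d.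
        - apply (Sec (fun s t => sin s * e2 s t ^ 2)); c2d. }
      rewrite EJ.
      assert (L : - sin s * K s + cos s * dK s - / sin s * K s
                  <= circ (fun t => sin s * e1 s t ^ 2 - 2 * sin s * e s t ^ 2)).
      { unfold K, dK, Rminus. rewrite Ropp_mult_distr_l.
        rewrite <- !circ_scal
          by first [apply (Sec (fun s t => e s t ^ 2)); c2d
                   | apply (Sec (fun s t => 2 * e s t * e1 s t)); c2d].
        assert (Cc : C1D (fun t => - sin s * e s t ^ 2))
          by (apply (Sec (fun s t => - sin s * e s t ^ 2)); c2d).
        assert (Cd : C1D (fun t => cos s * (2 * e s t * e1 s t)))
          by (apply (Sec (fun s t => cos s * (2 * e s t * e1 s t))); c2d).
        assert (Cf : C1D (fun t => - / sin s * e s t ^ 2)).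
        { assert (C1D (e s)) by now apply Sec. c2d. }
        assert (Cg : C1D (fun t => - sin s * e s t ^ 2 + cos s * (2 * e s t * e1 s t)))
          by (apply (Sec (fun s t => - sin s * e s t ^ 2 + cos s * (2 * e s t * e1 s t))); c2d).
        rewrite <- !circ_plus by assumption.
        apply circ_le.
        - assert (C1D (e s)) by now apply Sec. assert (C1D (e1 s)) by now apply Sec. c2d.
        - assert (C1D (e s)) by now apply Sec. assert (C1D (e1 s)) by now apply Sec. c2d.
        - intros t.
          assert (0 <= sin s * (e1 s t - cos s / sin s * e s t) ^ 2)
            by (apply Rmult_le_pos; [lra | apply pow2_ge_0]).
          assert (Hi : sin s * (e1 s t - cos s / sin s * e s t) ^ 2
                  = sin s * e1 s t ^ 2 - 2 * cos s * e s t * e1 s t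
                    + (/ sin s - sin s) * e s t ^ 2).
          { generalize (sin2_cos2 s); unfold Rsqr; intros Hsc.
            replace (/ sin s - sin s) with (cos s ^ 2 / sin s); [field; lra |].
            replace (cos s ^ 2) with (1 - sin s * sin s) by lra. field; lra. }
          lra. }
      assert (/ sin s * K s <= sin s * circ (fun t => e2 s t ^ 2)).
      { apply Rmult_le_reg_l with (sin s); [assumption |].
        rewrite <- Rmult_assoc, Rinv_r by lra. lra. }
      lra. }
  rewrite (Hpole PI sin_PI), (Hpole 0 sin_0), !Rmult_0_r in HT.
  unfold J in HT. rewrite sint_minus, sint_scal in HT by c2d. lra.
Qed.

(* At a itself the quotient is 0 / 0 = 0, which is the right value. *)
Lemma continuous_div_zeros (G S : R -> R) (a sg : R) :
  is_derive G a 0 -> G a = 0 -> is_derive S a sg -> S a = 0 -> sg <> 0 ->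
  continuous (fun x => G x / S x) a.
Proof.
  intros [_ HG] Ga [_ HS] Sa Hsg.
  apply continuity_pt_filterlim. intros eps Heps.
  assert (Hs : 0 < Rabs sg) by now apply Rabs_pos_lt.
  assert (He : 0 < eps * Rabs sg / 4) by (apply Rdiv_lt_0_compat; [apply Rmult_lt_0_compat |]; lra).
  assert (Hh : 0 < Rabs sg / 2) by lra.
  destruct (HG a (fun P H => H) (mkposreal _ He)) as [d1 H1].
  destruct (HS a (fun P H => H) (mkposreal _ Hh)) as [d2 H2].
  exists (Rmin d1 d2); split; [apply Rmin_pos; apply cond_pos |].
  intros y [_ Hy]; simpl in Hy; unfold Rdist in Hy.
  specialize (H1 y (Rlt_le_trans _ _ _ Hy (Rmin_l _ _))).
  specialize (H2 y (Rlt_le_trans _ _ _ Hy (Rmin_r _ _))).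
  simpl in H1, H2.
  change (Rabs (G y - G a - (y - a) * 0) <= eps * Rabs sg / 4 * Rabs (y - a)) in H1.
  change (Rabs (S y - S a - (y - a) * sg) <= Rabs sg / 2 * Rabs (y - a)) in H2.
  rewrite Ga in H1; rewrite Sa in H2.
  replace (G y - 0 - (y - a) * 0) with (G y) in H1 by ring.
  simpl; unfold Rdist. rewrite Ga, Sa.
  replace (G y / S y - 0 / 0) with (G y / S y) by (unfold Rdiv; rewrite Rinv_0; ring).
  destruct (Req_dec y a) as [->|Hya].
  { rewrite Ga. unfold Rdiv; rewrite Rmult_0_l, Rabs_R0; assumption. }
  assert (Hp : 0 < Rabs (y - a)) by (apply Rabs_pos_lt; lra).
  assert (HSl : Rabs sg / 2 * Rabs (y - a) <= Rabs (S y)).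
  { generalize (Rabs_triang (S y) (- (S y - 0 - (y - a) * sg))).
    rewrite Rabs_Ropp.
    replace (S y + - (S y - 0 - (y - a) * sg)) with ((y - a) * sg) by ring.
    rewrite Rabs_mult. intros; nra. }
  assert (0 < Rabs (S y)) by nra.
  unfold Rdiv; rewrite Rabs_mult, Rabs_inv.
  apply Rmult_lt_reg_r with (Rabs (S y)); [assumption |].
  rewrite Rmult_assoc, Rinv_l, Rmult_1_r by lra.
  apply Rle_lt_trans with (1 := H1).
  apply Rlt_le_trans with (eps * (Rabs sg / 2 * Rabs (y - a))); [| apply Rmult_le_compat_l; lra].
  assert (0 < eps * (Rabs sg * Rabs (y - a))) by (repeat apply Rmult_lt_0_compat; lra).
  lra.
Qed.

(* With G the antiderivative of sin * k, the integrand minus T' is the sum of squares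
   sin * (k' + 2 G / sin)^2 + 2 * sin * (k - 2 * cos * G / sin^2)^2. *)
Lemma poincare_zonal (k dk : R -> R) :
  (forall s, is_derive k s (dk s)) -> C1D dk ->
  RInt (fun s => sin s * k s) 0 PI = 0 ->
  2 * RInt (fun s => sin s * k s ^ 2) 0 PI <= RInt (fun s => sin s * dk s ^ 2) 0 PI.
Proof.
  intros Hk Cdk H0; pose proof PI_RGT_0 as Hpi.
  assert (Ck : C1D k) by (eapply C1D_derive; eauto).
  set (G := fun s => RInt (fun x => sin x * k x) 0 s).
  assert (HG : forall s, is_derive G s (sin s * k s)).
  { assert (Cg : C1D (fun x => sin x * k x)) by c2d. intros s.
    apply (is_derive_RInt (V := R_NormedModule) (fun x => sin x * k x) G 0 s); [| apply Cg].
    apply filter_forall; intros y; apply (RInt_correct (V := R_CompleteNormedModule)).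
    now apply C1D_ex_RInt. }
  assert (CG : C1D G) by exact (C1D_derive _ _ HG).
  assert (G0 : G 0 = 0) by (unfold G; rewrite RInt_point; reflexivity).
  assert (G1 : G PI = 0) by exact H0.
  set (T := fun s => - 4 * (G s * k s) + 4 * cos s * (G s / sin s) ^ 2).
  set (dT := fun s => - 4 * (sin s * k s * k s + G s * dk s)
     + 4 * (2 * cos s * G s * k s / sin s - 2 * G s ^ 2 / sin s ^ 3 + G s ^ 2 / sin s)).
  set (J := fun s => sin s * dk s ^ 2 - 2 * (sin s * k s ^ 2)).
  assert (Cq : forall s, 0 <= s <= PI -> continuous (fun s => G s / sin s) s).
  { assert (Hsin : forall s, is_derive sin s (cos s)) by (intros; auto_derive; [easy | ring]).
    intros s Hs.
    destruct (Req_dec s 0) as [->|]; [| destruct (Req_dec s PI) as [->|]].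
    - apply continuous_div_zeros with (cos 0); auto using sin_0.
      + generalize (HG 0); rewrite sin_0, Rmult_0_l; auto.
      + rewrite cos_0; lra.
    - apply continuous_div_zeros with (cos PI); auto using sin_PI.
      + generalize (HG PI); rewrite sin_PI, Rmult_0_l; auto.
      + rewrite cos_PI; lra.
    - assert (0 < sin s) by (apply sin_gt_0; lra).
      apply (continuous_mult (K := R_AbsRing) G (fun s => / sin s)); [apply CG |].
      apply continuous_Rinv_comp; [apply C1D_sin | lra]. }
  assert (HT : T PI - T 0 <= RInt J 0 PI).
  { apply RInt_ge_increment with dT; try lra.
    - intros s Hs. assert (Hsin : 0 < sin s) by (apply sin_gt_0; lra).
      unfold T, dT. auto_derive.
      + repeat split; try (eexists; first [apply HG | apply Hk]); lra.
      + dsub.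
        generalize (sin2_cos2 s); unfold Rsqr; intros Hsc.
        assert (Hc : cos s * cos s = 1 - sin s * sin s) by lra.
        field_simplify_eq; [| lra].
        assert (Hc2 : cos s ^ 2 = 1 - sin s ^ 2) by lra. rewrite ?Hc2. ring.
    - intros s Hs. unfold T.
      apply (continuous_plus (V := R_NormedModule)
        (fun s => - 4 * (G s * k s)) (fun s => 4 * cos s * (G s / sin s) ^ 2)).
      + assert (Ca : C1D (fun s => - 4 * (G s * k s))) by c2d. apply Ca.
      + apply (continuous_mult (K := R_AbsRing) (fun s => 4 * cos s) (fun s => (G s / sin s) ^ 2)).
        * assert (Ca : C1D (fun s => 4 * cos s)) by c2d. apply Ca.
        * assert (Ca : C1D (fun x => x ^ 2)) by c2d.
          apply (continuous_comp (fun s => G s / sin s) (fun x => x ^ 2)); [now apply Cq | apply Ca].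
    - unfold J; c2d.
    - intros s Hs. assert (Hsin : 0 < sin s) by (apply sin_gt_0; lra).
      assert (0 <= sin s * (dk s + 2 * G s / sin s) ^ 2)
        by (apply Rmult_le_pos; [lra | apply pow2_ge_0]).
      assert (0 <= 2 * (sin s * (k s - 2 * cos s * G s / sin s ^ 2) ^ 2))
        by (apply Rmult_le_pos; [lra | apply Rmult_le_pos; [lra | apply pow2_ge_0]]).
      assert (E : J s - dT s = sin s * (dk s + 2 * G s / sin s) ^ 2
                  + 2 * (sin s * (k s - 2 * cos s * G s / sin s ^ 2) ^ 2)).
      { generalize (sin2_cos2 s); unfold Rsqr; intros Hsc.
        unfold J, dT. field_simplify_eq; [| lra].
        assert (Hc2 : cos s ^ 2 = 1 - sin s ^ 2) by lra. rewrite ?Hc2. ring. }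
      lra. }
  unfold T in HT; rewrite G0, G1 in HT.
  unfold J in HT.
  rewrite RInt_C1D_minus, RInt_C1D_scal in HT by c2d.
  lra.
Qed.
Lemma circ_split_mean (f : R -> R) (c : R) :
  C1D f ->
  circ (fun t => (f t - c) ^ 2)
  = circ (fun t => (f t - circ f / (2 * PI)) ^ 2) + 2 * PI * (circ f / (2 * PI) - c) ^ 2.
Proof.
  intros Hf; pose proof PI_RGT_0 as Hpi. set (m := circ f / (2 * PI)).
  assert (Hm : circ f = 2 * PI * m) by (unfold m; field; lra).
  assert (E : forall d, circ (fun t => (f t - d) ^ 2)
            = circ (fun t => f t ^ 2) + (- 2 * d * (2 * PI * m) + 2 * PI * d ^ 2)).
  { intros d. rewrite <- Hm, <- circ_const, <- circ_scal by c2d.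
    rewrite <- !circ_plus by c2d. apply circ_ext; intros; ring. }
  rewrite !E. ring.
Qed.

(** Orthogonal splitting [h = hb + e] into the mean over each circle and a remainder of mean zero on
    each circle. Both sides of the inequality split accordingly, because averaging over [t] commutes
    with the derivative in [s] and [hb] does not depend on [t]. The zonal part and the remainder are
    then treated separately. *)
Lemma poincare (h c1 c2 : R -> R -> R) (m : R) :
  (forall s t, is_derive (fun z => h z t) s (c1 s t)) ->
  (forall s t, is_derive (fun z => h s z) t (sin s * c2 s t)) ->
  C2D h -> C2D c1 -> C2D c2 ->
  (forall s t, h s (t + 2 * PI) = h s t) -> (forall s t, c2 s (t + 2 * PI) = c2 s t) ->
  sint (fun s t => sin s * h s t) = 4 * PI * m ->
  2 * sint (fun s t => sin s * (h s t - m) ^ 2)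
  <= sint (fun s t => sin s * (c1 s t ^ 2 + c2 s t ^ 2)).
Proof.
  intros Hs Ht Ch Cc1 Cc2 Ph Pc2 Hm; pose proof PI_RGT_0 as Hpi.
  assert (Sec : forall g s, C2D g -> C1D (g s)) by (intros; now apply C2D_section).
  set (hb := fun s => circ (h s) / (2 * PI)).
  set (db := fun s => circ (c1 s) / (2 * PI)).
  assert (Hhb : forall s, is_derive hb s (db s)).
  { intros s; unfold hb, db, Rdiv.
    apply (is_derive_ext (fun s => / (2 * PI) * circ (h s))); [intros; apply Rmult_comm |].
    rewrite (Rmult_comm (circ (c1 s))). apply (is_derive_scal (fun s => circ (h s))).
    apply circ_derive; auto. }
  assert (Cdb : C1D db).
  { assert (Cc : C1D (fun s => circ (c1 s))) by now apply circ_C1D.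
    set (g := fun s => circ (c1 s)) in Cc.
    change (C1D (fun s => g s / (2 * PI))). unfold Rdiv; c2d. }
  assert (Chb : C1D hb) by exact (C1D_derive _ _ Hhb).
  set (e := fun s t => h s t - hb s).
  set (e1 := fun s t => c1 s t - db s).
  assert (Ce : C2D e) by (unfold e; c2d).
  assert (Ce1 : C2D e1) by (unfold e1; c2d).
  assert (N := poincare_mean_zero_circles e e1 c2).
  assert (He : forall s, circ (e s) = 0).
  { intros s; unfold e, Rminus. rewrite circ_plus, circ_const by (try apply Sec; c2d).
    unfold hb; field; lra. }
  specialize (N ltac:(intros; apply (is_derive_minus (K := R_AbsRing) (V := R_NormedModule) (fun z => h z t) hb); auto)).
  assert (Het : forall s t, is_derive (fun z => e s z) t (sin s * c2 s t)).
  { intros s t; unfold e. auto_derive; [eexists; apply Ht | dsub; ring]. }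
  specialize (N Het Ce Ce1 Cc2).
  specialize (N ltac:(intros; unfold e; now rewrite Ph) Pc2 He).
  set (k := fun s => hb s - m).
  assert (Z := poincare_zonal k db).
  assert (Hk : forall s, is_derive k s (db s)).
  { intros s; unfold k; auto_derive; [eexists; apply Hhb | dsub; ring]. }
  assert (Ck : C1D k) by exact (C1D_derive _ _ Hk).
  assert (Hk0 : RInt (fun s => sin s * k s) 0 PI = 0).
  { assert (E : 2 * PI * RInt (fun s => sin s * k s) 0 PI
                = sint (fun s t => sin s * h s t - m * sin s)).
    { rewrite <- RInt_C1D_scal by c2d. apply RInt_real_ext; intros s _.
      rewrite (circ_ext _ (fun t => sin s * h s t + - (m * sin s))) by (intros; ring).
      assert (Cs : C1D (h s)) by now apply Sec.
      rewrite circ_plus, circ_const, circ_scal by c2d.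
      unfold k, hb; field; lra. }
    rewrite sint_minus, sint_scal, sint_sin, Hm in E by c2d.
    assert (X : 2 * PI * RInt (fun s => sin s * k s) 0 PI = 0) by (rewrite E; ring).
    apply Rmult_integral in X; destruct X; lra. }
  specialize (Z Hk Cdb Hk0).
  assert (E1 : sint (fun s t => sin s * (h s t - m) ^ 2)
     = sint (fun s t => sin s * e s t ^ 2) + 2 * PI * RInt (fun s => sin s * k s ^ 2) 0 PI).
  { rewrite <- RInt_C1D_scal by c2d. unfold sint.
    rewrite <- RInt_C1D_plus; [| apply circ_C1D; c2d | c2d].
    apply RInt_real_ext; intros s _.
    assert (Cs : C1D (h s)) by now apply Sec.
    assert (Cs' : C1D (e s)) by now apply Sec.
    rewrite !circ_scal by c2d.
    rewrite (circ_split_mean (h s) m Cs). fold (hb s). unfold e, k; ring. }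
  assert (E2 : sint (fun s t => sin s * (c1 s t ^ 2 + c2 s t ^ 2))
     = sint (fun s t => sin s * (e1 s t ^ 2 + c2 s t ^ 2))
       + 2 * PI * RInt (fun s => sin s * db s ^ 2) 0 PI).
  { rewrite <- RInt_C1D_scal by c2d. unfold sint.
    rewrite <- RInt_C1D_plus; [| apply circ_C1D; c2d | c2d].
    apply RInt_real_ext; intros s _.
    assert (Cs : C1D (c1 s)) by now apply Sec.
    assert (Cs' : C1D (e1 s)) by now apply Sec.
    assert (Cs'' : C1D (c2 s)) by now apply Sec.
    rewrite !circ_scal, !circ_plus by c2d.
    assert (X := circ_split_mean (c1 s) 0 Cs). fold (db s) in X.
    rewrite (circ_ext _ (fun t => c1 s t ^ 2)) in X by (intros; ring).
    rewrite X. unfold e1; ring. }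
  rewrite E1, E2.
  assert (0 <= 2 * PI * (RInt (fun s => sin s * db s ^ 2) 0 PI
      - 2 * RInt (fun s => sin s * k s ^ 2) 0 PI)) by (apply Rmult_le_pos; lra).
  lra.
Qed.

(** * Integration by parts on the sphere *)

(** In the application [Y1] contains the factor [sin s], so its vanishing at 0 and [PI] says that no
    flux passes through the poles; periodicity closes the integral in [t]. *)
Lemma sint_divergence (Y1 Y2 dY1 dY2 : R -> R -> R) :
  (forall s t, is_derive (fun z => Y1 z t) s (dY1 s t)) ->
  (forall s t, is_derive (fun z => Y2 s z) t (dY2 s t)) ->
  C2D Y1 -> C2D dY1 -> C2D dY2 ->
  (forall t, Y1 0 t = 0) -> (forall t, Y1 PI t = 0) ->
  (forall s t, Y2 s (t + 2 * PI) = Y2 s t) ->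
  sint (fun s t => dY1 s t + dY2 s t) = 0.
Proof.
  intros H1 H2 C1 Cd1 Cd2 Z0 Z1 P2.
  rewrite sint_plus by assumption.
  assert (E2 : sint dY2 = 0).
  { unfold sint. transitivity (RInt (fun _ => 0) 0 PI).
    - apply RInt_real_ext; intros s _.
      transitivity (Y2 s (2 * PI) - Y2 s 0).
      + apply (is_RInt_unique (V := R_CompleteNormedModule)).
        apply (is_RInt_derive (V := R_CompleteNormedModule) (Y2 s)); intros.
        * apply H2.
        * now apply (C2D_section dY2).
      + generalize (P2 s 0); rewrite Rplus_0_l; lra.
    - rewrite RInt_const; unfold scal; simpl; unfold mult; simpl; ring. }
  assert (E1 : sint dY1 = circ (Y1 PI) - circ (Y1 0)).
  { apply (is_RInt_unique (V := R_CompleteNormedModule)).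
    apply (is_RInt_derive (V := R_CompleteNormedModule) (fun s => circ (Y1 s))); intros.
    - apply circ_derive; auto. intros; now apply C2D_section.
    - now apply circ_C1D. }
  rewrite E1, E2, (circ_ext (Y1 PI) (fun _ => 0)), (circ_ext (Y1 0) (fun _ => 0)) by assumption.
  ring.
Qed.

(** * Curvature of the warped product metric *)

Definition dss_christoffel (u du : R -> R) (k i j : ix) (x : vec) : R :=
  match k, i, j with
  | i0, i1, i1 => - (u (x i0) * du (x i0))
  | i0, i2, i2 => - (u (x i0) * du (x i0) * sin (x i1) ^ 2)
  | i1, i0, i1 | i1, i1, i0 | i2, i0, i2 | i2, i2, i0 => du (x i0) / u (x i0)
  | i1, i2, i2 => - (sin (x i1) * cos (x i1))
  | i2, i1, i2 | i2, i2, i1 => cos (x i1) / sin (x i1)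
  | _, _, _ => 0
  end.

(** The first index is the direction of differentiation. The sum [sin ^ 2 + cos ^ 2] is left as it
    stands because the entries are checked by [field], which treats sine and cosine as
    independent. *)
Definition dss_dchristoffel (u du ddu : R -> R) (m k i j : ix) (x : vec) : R :=
  match m, k, i, j with
  | i0, i0, i1, i1 => - (du (x i0) ^ 2 + u (x i0) * ddu (x i0))
  | i0, i0, i2, i2 => - ((du (x i0) ^ 2 + u (x i0) * ddu (x i0)) * sin (x i1) ^ 2)
  | i0, i1, i0, i1 | i0, i1, i1, i0 | i0, i2, i0, i2 | i0, i2, i2, i0 =>
      (ddu (x i0) * u (x i0) - du (x i0) ^ 2) / u (x i0) ^ 2
  | i1, i0, i2, i2 => - (2 * u (x i0) * du (x i0) * sin (x i1) * cos (x i1))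
  | i1, i1, i2, i2 => sin (x i1) ^ 2 - cos (x i1) ^ 2
  | i1, i2, i1, i2 | i1, i2, i2, i1 => - (sin (x i1) ^ 2 + cos (x i1) ^ 2) / sin (x i1) ^ 2
  | _, _, _, _ => 0
  end.

Section Curvature.

Variables u du ddu : R -> R.
Hypothesis u_pos : forall z, 0 < u z.
Hypothesis u_derive : forall z, is_derive u z (du z).
Hypothesis du_derive : forall z, is_derive du z (ddu z).

Lemma dss_inv3 (x : vec) (i j : ix) :
  sin (x i1) <> 0 ->
  inv3 (dss_metric u x) i j
  = match i, j with
    | i0, i0 => 1
    | i1, i1 => / u (x i0) ^ 2
    | i2, i2 => / (u (x i0) ^ 2 * sin (x i1) ^ 2)
    | _, _ => 0
    end.
Proof.
  intros Hs. generalize (u_pos (x i0)); intros Hu.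
  destruct i, j; unfold inv3, det3, sum3, cofactor; simpl nxt; cbn -[pow]; field; split; lra.
Qed.

Lemma dss_christoffelE (x : vec) (k i j : ix) :
  sin (x i1) <> 0 ->
  christoffel (dss_metric u) k i j x = dss_christoffel u du k i j x.
Proof.
  intros Hs. generalize (u_pos (x i0)); intros Hu.
  assert (D0 : forall c, Derive (fun _ : R => c) (x i0) = 0) by (intros; apply Derive_const).
  assert (E0 : Derive (fun z => u z ^ 2) (x i0) = 2 * u (x i0) * du (x i0)).
  { apply is_derive_unique; auto_derive; [eexists; apply u_derive | dsub; ring]. }
  assert (E1 : forall c, Derive (fun z => u z ^ 2 * c) (x i0) = 2 * u (x i0) * du (x i0) * c).
  { intros c; apply is_derive_unique; auto_derive; [eexists; apply u_derive | dsub; ring]. }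
  assert (E2 : forall c, Derive (fun z => c * sin z ^ 2) (x i1) = c * (2 * sin (x i1) * cos (x i1))).
  { intros c; apply is_derive_unique; auto_derive; [easy | ring]. }
  destruct k, i, j; unfold christoffel, sum3; rewrite !dss_inv3 by assumption;
    unfold partial, upd, dss_metric; cbn -[pow];
    rewrite ?E0, ?E1, ?E2, ?Derive_const; field; repeat split; lra.
Qed.

Lemma partial_dss_christoffel (x : vec) (m k i j : ix) :
  sin (x i1) <> 0 ->
  partial m (christoffel (dss_metric u) k i j) x = dss_dchristoffel u du ddu m k i j x.
Proof.
  intros Hs. generalize (u_pos (x i0)); intros Hu.
  unfold partial.
  transitivity (Derive (fun t => dss_christoffel u du k i j (upd x m t)) (x m)).
  (* The closed form of the Christoffel symbols is available only where [sin] is nonzero, an open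
     condition, so the two functions are compared near the point only. *)
  { apply Derive_ext_loc.
    assert (L : locally (x m) (fun t => sin (upd x m t i1) <> 0)).
    { destruct m; unfold upd; simpl.
      1,3: apply filter_forall; intros; assumption.
      assert (H := C1D_sin (x i1)).
      apply (H (fun y => y <> 0)).
      apply (open_neq 0 (sin (x i1)) Hs). }
    revert L; apply filter_imp; intros t Ht; now apply dss_christoffelE. }
  apply is_derive_unique.
  assert (Xu : forall z, ex_derive u z) by (intros z; eexists; apply u_derive).
  assert (Xdu : forall z, ex_derive du z) by (intros z; eexists; apply du_derive).
  destruct m, k, i, j; unfold dss_christoffel, dss_dchristoffel, upd; simpl ix_eqb; cbv iota;
    try apply (is_derive_const (K := R_AbsRing) (V := R_NormedModule));
    (auto_derive;
     [repeat match goal with |- _ /\ _ => split end;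
      lazymatch goal with
      | |- ex_derive (fun _ => u _) _ => apply Xu
      | |- ex_derive (fun _ => du _) _ => apply Xdu
      | |- True => exact I
      | |- sin _ <> 0 => assumption
      | |- _ => lra
      end
     | dsub; field; try split; lra]).
Qed.

(** The metric [dr^2 + u^2 g_{S^2}] has scalar curvature [2 (1 - u'^2) / u^2 - 4 u'' / u]; the
    profile equation is the statement that this equals 2. *)
Lemma dss_scalar_curvature (x : vec) :
  sin (x i1) <> 0 ->
  (forall z, ddu z = / 2 * ((1 - du z ^ 2) / u z) - u z / 2) ->
  scalar_curvature (dss_metric u) x = 2.
Proof.
  intros Hs Hode. generalize (u_pos (x i0)); intros Hu.
  unfold scalar_curvature, sum3. rewrite !dss_inv3 by assumption.
  unfold ricci, sum3.
  repeat rewrite partial_dss_christoffel by assumption.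
  repeat rewrite dss_christoffelE by assumption.
  cbn -[pow]. rewrite Hode.
  generalize (sin2_cos2 (x i1)); unfold Rsqr; intros Hsc.
  assert (Hc2 : cos (x i1) ^ 2 = 1 - sin (x i1) ^ 2) by lra.
  field_simplify_eq; [| split; lra].
  rewrite ?Hc2; ring.
Qed.

Lemma dss_Lambda_eq :
  (forall z, ddu z = / 2 * ((1 - du z ^ 2) / u z) - u z / 2) -> dss_Lambda u = 2.
Proof.
  intros Hode. unfold dss_Lambda, inf_scalar_curvature.
  rewrite (is_glb_Rbar_unique _ (Finite 2)); [reflexivity |].
  assert (E : forall x, chart_domain x -> scalar_curvature (dss_metric u) x = 2).
  { intros x [H1 H2]; apply dss_scalar_curvature; [| assumption].
    apply Rgt_not_eq, sin_gt_0; assumption. }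
  split.
  - intros y [x [Hx ->]]. rewrite E by assumption. simpl; lra.
  - intros b Hb. apply (Hb 2). exists (mkvec 0 (PI / 2) 0).
    assert (Hx : chart_domain (mkvec 0 (PI / 2) 0))
      by (unfold chart_domain; simpl; generalize PI_RGT_0; lra).
    split; [assumption | now rewrite E].
Qed.

End Curvature.

(** * Graphs over the sphere *)

(* The data of a C^2 function f on the sphere in spherical coordinates, with its
   derivatives in the orthonormal frame e1 = d/ds, e2 = (1 / sin s) d/dt: b1, b2 is the
   gradient and a11, a12, a22 the covariant Hessian.  All of these are continuous also
   at the poles, where e1, e2 depends on t. *)
Record sphere_frame (f b1 b2 a11 a12 a22 : R -> R -> R) : Prop := {
  sf_s : forall s t, is_derive (fun z => f z t) s (b1 s t);
  sf_t : forall s t, is_derive (fun z => f s z) t (sin s * b2 s t);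
  sf_1s : forall s t, is_derive (fun z => b1 z t) s (a11 s t);
  sf_1t : forall s t, is_derive (fun z => b1 s z) t (sin s * a12 s t + cos s * b2 s t);
  sf_2s : forall s t, is_derive (fun z => b2 z t) s (a12 s t);
  sf_2t : forall s t, is_derive (fun z => b2 s z) t (sin s * a22 s t - cos s * b1 s t);
  sf_C : C2D f;
  sf_C1 : C2D b1;
  sf_C2 : C2D b2;
  sf_C11 : C2D a11;
  sf_C12 : C2D a12;
  sf_C22 : C2D a22;
  sf_P : forall s t, f s (t + 2 * PI) = f s t;
  sf_P1 : forall s t, b1 s (t + 2 * PI) = b1 s t;
  sf_P2 : forall s t, b2 s (t + 2 * PI) = b2 s t }.

Section Graph.

Variables u du ddu : R -> R.
Hypothesis u_pos : forall z, 0 < u z.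
Hypothesis u_derive : forall z, is_derive u z (du z).
Hypothesis du_derive : forall z, is_derive du z (ddu z).

Variables f b1 b2 a11 a12 a22 : R -> R -> R.
Hypothesis Hf : sphere_frame f b1 b2 a11 a12 a22.

Definition gq (s t : R) : R := b1 s t ^ 2 + b2 s t ^ 2.
Definition gS (s t : R) : R := sqrt (u (f s t) ^ 2 + gq s t).

(* The divergence on the round sphere of grad f / sqrt (u(f)^2 + |grad f|^2). *)
Definition gD (s t : R) : R :=
  ((u (f s t) ^ 2 + b2 s t ^ 2) * a11 s t + (u (f s t) ^ 2 + b1 s t ^ 2) * a22 s t
   - 2 * b1 s t * b2 s t * a12 s t - u (f s t) * du (f s t) * gq s t) / gS s t ^ 3.

Lemma gq_pos s t : 0 <= gq s t.
Proof. unfold gq; generalize (pow2_ge_0 (b1 s t)) (pow2_ge_0 (b2 s t)); lra. Qed.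

Lemma gS_arg_pos s t : 0 < u (f s t) ^ 2 + gq s t.
Proof.
  generalize (gq_pos s t), (pow_lt (u (f s t)) 2 (u_pos _)); lra.
Qed.

Lemma gS_pos s t : 0 < gS s t.
Proof. apply sqrt_lt_R0, gS_arg_pos. Qed.

Lemma gS_sqr s t : gS s t ^ 2 = u (f s t) ^ 2 + gq s t.
Proof. unfold gS; rewrite pow2_sqrt; [reflexivity | apply Rlt_le, gS_arg_pos]. Qed.

Let F : surface := fun s t => mkvec (f s t) s t.

Lemma graph_d1 s t : d1 F s t = mkvec (b1 s t) 1 0.
Proof.
  apply functional_extensionality; intros [| |]; unfold d1, F; simpl.
  - apply is_derive_unique, (sf_s _ _ _ _ _ _ Hf).
  - apply Derive_id.
  - apply Derive_const.
Qed.

Lemma graph_d2 s t : d2 F s t = mkvec (sin s * b2 s t) 0 1.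
Proof.
  apply functional_extensionality; intros [| |]; unfold d2, F; simpl.
  - apply is_derive_unique, (sf_t _ _ _ _ _ _ Hf).
  - apply Derive_const.
  - apply Derive_id.
Qed.

Lemma graph_d11 s t : d1 (d1 F) s t = mkvec (a11 s t) 0 0.
Proof.
  replace (d1 F) with (fun s t => mkvec (b1 s t) 1 0)
    by (apply functional_extensionality; intros; apply functional_extensionality; intros;
        symmetry; apply graph_d1).
  apply functional_extensionality; intros [| |]; unfold d1; simpl.
  - apply is_derive_unique, (sf_1s _ _ _ _ _ _ Hf).
  - apply Derive_const.
  - apply Derive_const.
Qed.

Lemma graph_d12 s t : d1 (d2 F) s t = mkvec (sin s * a12 s t + cos s * b2 s t) 0 0.
Proof.
  replace (d2 F) with (fun s t => mkvec (sin s * b2 s t) 0 1)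
    by (apply functional_extensionality; intros; apply functional_extensionality; intros;
        symmetry; apply graph_d2).
  apply functional_extensionality; intros [| |]; unfold d1; simpl.
  - apply is_derive_unique. generalize (sf_2s _ _ _ _ _ _ Hf); intros H.
    auto_derive; [eexists; apply H | dsub; ring].
  - apply Derive_const.
  - apply Derive_const.
Qed.

Lemma graph_d22 s t :
  d2 (d2 F) s t = mkvec (sin s * (sin s * a22 s t - cos s * b1 s t)) 0 0.
Proof.
  replace (d2 F) with (fun s t => mkvec (sin s * b2 s t) 0 1)
    by (apply functional_extensionality; intros; apply functional_extensionality; intros;
        symmetry; apply graph_d2).
  apply functional_extensionality; intros [| |]; unfold d2; simpl.
  - apply is_derive_unique. generalize (sf_2t _ _ _ _ _ _ Hf); intros H.
    auto_derive; [eexists; apply H | dsub; ring].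
  - apply Derive_const.
  - apply Derive_const.
Qed.

Let g := dss_metric u.

Lemma graph_first_form s t :
  first_form g F (d1 F) (d1 F) s t = b1 s t ^ 2 + u (f s t) ^ 2 /\
  first_form g F (d1 F) (d2 F) s t = sin s * b1 s t * b2 s t /\
  first_form g F (d2 F) (d2 F) s t = sin s ^ 2 * (b2 s t ^ 2 + u (f s t) ^ 2).
Proof.
  unfold first_form; rewrite graph_d1, graph_d2.
  unfold inner, sum3, g, F; simpl; repeat split; ring.
Qed.

Lemma graph_gram s t :
  gram_det g F s t = (sin s * u (f s t)) ^ 2 * gS s t ^ 2.
Proof.
  unfold gram_det. destruct (graph_first_form s t) as [-> [-> ->]].
  rewrite gS_sqr; unfold gq; ring.
Qed.

Lemma graph_area_element s t :
  0 < sin s -> area_element g F s t = sin s * (u (f s t) * gS s t).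
Proof.
  intros Hs. unfold area_element. rewrite graph_gram.
  generalize (u_pos (f s t)) (gS_pos s t); intros H1 H2.
  replace ((sin s * u (f s t)) ^ 2 * gS s t ^ 2)
    with ((sin s * (u (f s t) * gS s t)) * (sin s * (u (f s t) * gS s t))) by ring.
  apply sqrt_square, Rlt_le; repeat apply Rmult_lt_0_compat; assumption.
Qed.

(** The cross product of the coordinate tangents is the differential of [r - f], so the normal
    obtained by raising the index points towards increasing [r]. *)
Lemma graph_unit_normal s t :
  0 < sin s ->
  unit_normal g F s t
  = mkvec (u (f s t) / gS s t) (- b1 s t / (u (f s t) * gS s t))
          (- b2 s t / (sin s * (u (f s t) * gS s t))).
Proof.
  intros Hs. generalize (u_pos (f s t)) (gS_pos s t); intros Hu HS.
  assert (N : normal g F s t = mkvec 1 (- b1 s t / u (f s t) ^ 2)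
                                     (- b2 s t / (sin s * u (f s t) ^ 2))).
  { apply functional_extensionality; intros k. unfold normal, sum3, g.
    rewrite !dss_inv3 by (first [assumption | simpl; lra]).
    rewrite graph_d1, graph_d2. unfold F.
    destruct k; unfold cross; cbn -[pow]; field; repeat split; lra. }
  assert (M : inner g (F s t) (normal g F s t) (normal g F s t) = (gS s t / u (f s t)) ^ 2).
  { rewrite N. replace ((gS s t / u (f s t)) ^ 2) with (gS s t ^ 2 / u (f s t) ^ 2) by (field; lra).
    rewrite gS_sqr. unfold inner, sum3, g, F, gq; cbn -[pow].
    field; lra. }
  unfold unit_normal; rewrite M, N, sqrt_pow2
    by (apply Rlt_le, Rdiv_lt_0_compat; assumption).
  apply functional_extensionality; intros [| |]; cbn -[pow]; field; repeat split; lra.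
Qed.

Lemma graph_mean_curvature s t :
  0 < sin s ->
  mean_curvature g F s t = gD s t / u (f s t) - 2 * du (f s t) / gS s t.
Proof.
  intros Hs. generalize (u_pos (f s t)) (gS_pos s t); intros Hu HS.
  assert (HF : sin (F s t i1) <> 0) by (unfold F; simpl; lra).
  assert (II : forall X Y Z,
    second_form g F X Y Z s t
    = (u (f s t) / gS s t) * (Z s t i0 - u (f s t) * du (f s t) * (X s t i1 * Y s t i1)
         - u (f s t) * du (f s t) * sin s ^ 2 * (X s t i2 * Y s t i2))
      - u (f s t) * b1 s t / gS s t * (Z s t i1
         + du (f s t) / u (f s t) * (X s t i0 * Y s t i1 + X s t i1 * Y s t i0)
         - sin s * cos s * (X s t i2 * Y s t i2))
      - u (f s t) * sin s * b2 s t / gS s t * (Z s t i2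
         + du (f s t) / u (f s t) * (X s t i0 * Y s t i2 + X s t i2 * Y s t i0)
         + cos s / sin s * (X s t i1 * Y s t i2 + X s t i2 * Y s t i1))).
  { intros X Y Z. unfold second_form. rewrite graph_unit_normal by assumption.
    unfold inner, sum3, covariant, sum3, g.
    rewrite !(dss_christoffelE u du u_pos u_derive) by assumption.
    unfold F; cbn -[pow]. field; repeat split; lra. }
  unfold mean_curvature. rewrite !II, graph_gram.
  destruct (graph_first_form s t) as [-> [-> ->]].
  rewrite graph_d1, graph_d2, graph_d11, graph_d12, graph_d22. cbn -[pow].
  unfold gD.
  assert (E : gq s t = gS s t ^ 2 - u (f s t) ^ 2) by (rewrite gS_sqr; ring).
  (* An intermediate form without sine and cosine: they cancel because [a11], [a12], [a22] are
     covariant second derivatives. *)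
  transitivity (
   (u (f s t) / gS s t) * ((b2 s t ^ 2 + u (f s t) ^ 2) * (a11 s t - u (f s t) * du (f s t)
       - 2 * b1 s t ^ 2 * du (f s t) / u (f s t))
    - 2 * b1 s t * b2 s t * (a12 s t - 2 * b1 s t * b2 s t * du (f s t) / u (f s t))
    + (b1 s t ^ 2 + u (f s t) ^ 2) * (a22 s t - u (f s t) * du (f s t)
       - 2 * b2 s t ^ 2 * du (f s t) / u (f s t)))
   / (u (f s t) ^ 2 * gS s t ^ 2)).
  { field; repeat split; lra. }
  (* The relation [S ^ 2 = v ^ 2 + b1 ^ 2 + b2 ^ 2] is invisible to [ring]; eliminating the even
     powers of [b2] turns the goal into a polynomial identity. *)
  assert (Eb : b2 s t ^ 2 = gS s t ^ 2 - u (f s t) ^ 2 - b1 s t ^ 2)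
    by (rewrite gS_sqr; unfold gq; ring).
  rewrite E. field_simplify_eq; [| split; lra].
  assert (Eb4 : b2 s t ^ 4 = (gS s t ^ 2 - u (f s t) ^ 2 - b1 s t ^ 2) ^ 2)
    by (rewrite <- Eb; ring).
  rewrite ?Eb4, ?Eb. ring.
Qed.

End Graph.

(** * Spherical coordinates for C^2 functions on the sphere *)

Lemma upd_same (x : vec) (i : ix) : upd x i (x i) = x.
Proof. apply functional_extensionality; intros j; unfold upd; destruct i, j; reflexivity. Qed.

Lemma upd_upd (x : vec) (i : ix) (a b : R) : upd (upd x i a) i b = upd x i b.
Proof. apply functional_extensionality; intros j; unfold upd; destruct i, j; reflexivity. Qed.

Lemma upd_eq (x : vec) (i : ix) (a : R) : upd x i a i = a.
Proof. unfold upd; destruct i; reflexivity. Qed.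

Lemma mvt_partial (G : vec -> R) (y : vec) (i : ix) (t0 t1 : R) :
  (forall t, Rmin t0 t1 <= t <= Rmax t0 t1 -> ex_partial i G (upd y i t)) ->
  exists t, Rmin t0 t1 <= t <= Rmax t0 t1 /\
    G (upd y i t1) - G (upd y i t0) = partial i G (upd y i t) * (t1 - t0).
Proof.
  intros H.
  assert (D : forall t, Rmin t0 t1 <= t <= Rmax t0 t1 ->
    is_derive (fun z => G (upd y i z)) t (partial i G (upd y i t))).
  { intros t Ht. specialize (H t Ht). unfold ex_partial in H. unfold partial.
    rewrite upd_eq in *.
    apply (is_derive_ext (fun z => G (upd (upd y i t) i z))).
    - intros z; now rewrite upd_upd.
    - now apply Derive_correct. }
  destruct (MVT_gen (fun z => G (upd y i z)) t0 t1 (fun t => partial i G (upd y i t)))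
    as [c [Hc E]].
  - intros; apply D; lra.
  - intros x Hx; apply continuity_pt_filterlim.
    apply (ex_derive_continuous (K := R_AbsRing) (V := R_NormedModule)).
    eexists; now apply D.
  - now exists c.
Qed.

Lemma is_derive_0_intro (h : R -> R) (a : R) :
  (forall eps : posreal, locally a (fun y => Rabs (h y - h a) <= eps * Rabs (y - a))) ->
  is_derive h a 0.
Proof.
  intros H; split; [apply is_linear_scal_l |].
  intros x Hx. apply (is_filter_lim_locally_unique (K := R_AbsRing) (V := R_NormedModule)) in Hx; subst x.
  intros eps. generalize (H eps); apply filter_imp; intros y Hy.
  change (Rabs (h y - h a - (y - a) * 0) <= eps * Rabs (y - a)).
  now rewrite Rmult_0_r, Rminus_0_r.
Qed.

Lemma between_close (p y t d : R) :
  Rabs (y - p) < d -> Rmin p y <= t <= Rmax p y -> Rabs (t - p) < d.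
Proof.
  unfold Rmin, Rmax; intros H Ht; apply Rabs_def2 in H; apply Rabs_def1;
    destruct (Rle_dec p y); lra.
Qed.

(** The path from [p] to [y] changes one coordinate at a time. On each leg the mean value theorem
    gives a partial derivative at a nearby point, within [eps] of its value at [p]. *)
Lemma partial_linear_approx (G : vec -> R) (p : vec) :
  locally p (fun y => forall i, ex_partial i G y) ->
  (forall i, continuous (partial i G) p) ->
  forall eps : posreal, locally p (fun y =>
    Rabs (G y - G p - sum3 (fun i => partial i G p * (y i - p i)))
    <= eps * sum3 (fun i => Rabs (y i - p i))).
Proof.
  intros [d0 H0] Hc eps.
  assert (Hl : locally p (fun y => forall i, Rabs (partial i G y - partial i G p) < eps)).
  { assert (L : forall i, locally p (fun y => Rabs (partial i G y - partial i G p) < eps))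
      by (intros i; apply (Hc i _ (locally_ball (partial i G p) eps))).
    generalize (filter_and _ _ (L i0) (filter_and _ _ (L i1) (L i2))).
    apply filter_imp. intros y [? [? ?]] [| |]; assumption. }
  destruct Hl as [d1 H1].
  exists (mkposreal _ (Rmin_stable_in_posreal d0 d1)); intros y Hy.
  change (forall i, Rabs (y i - p i) < Rmin d0 d1) in Hy.
  assert (Hd : forall z : vec, (forall i, Rabs (z i - p i) < Rmin d0 d1) ->
     (forall i, ex_partial i G z) /\ forall i, Rabs (partial i G z - partial i G p) < eps).
  { intros z Hz; split; [apply H0 | apply H1]; intros i; apply Rlt_le_trans with (1 := Hz i);
      [apply Rmin_l | apply Rmin_r]. }
  assert (Hpos : 0 < Rmin d0 d1) by (apply Rmin_stable_in_posreal).
  assert (Hpp : forall i, Rabs (p i - p i) < Rmin d0 d1)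
    by (intros; rewrite Rminus_eq_0, Rabs_R0; assumption).
  set (y1 := upd p i0 (y i0)). set (y2 := upd y1 i1 (y i1)).
  assert (E0 : upd p i0 (p i0) = p) by apply upd_same.
  assert (E1 : upd y1 i1 (p i1) = y1) by apply (upd_same y1 i1).
  assert (E2 : upd y2 i2 (p i2) = y2) by apply (upd_same y2 i2).
  assert (E3 : upd y2 i2 (y i2) = y)
    by (apply functional_extensionality; intros [| |]; reflexivity).
  assert (B0 : forall t, Rmin (p i0) (y i0) <= t <= Rmax (p i0) (y i0) ->
    forall i, Rabs (upd p i0 t i - p i) < Rmin d0 d1).
  { intros t Ht [| |]; unfold upd; simpl; try apply Hpp.
    now apply between_close with (y i0). }
  assert (B1 : forall t, Rmin (p i1) (y i1) <= t <= Rmax (p i1) (y i1) ->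
    forall i, Rabs (upd y1 i1 t i - p i) < Rmin d0 d1).
  { intros t Ht [| |]; unfold y1, upd; simpl; try apply Hpp; try apply Hy.
    now apply between_close with (y i1). }
  assert (B2 : forall t, Rmin (p i2) (y i2) <= t <= Rmax (p i2) (y i2) ->
    forall i, Rabs (upd y2 i2 t i - p i) < Rmin d0 d1).
  { intros t Ht [| |]; unfold y2, y1, upd; simpl; try apply Hpp; try apply Hy.
    now apply between_close with (y i2). }
  destruct (mvt_partial G p i0 (p i0) (y i0)) as [t0 [Ht0 M0]];
    [intros; apply Hd; now apply B0 |].
  destruct (mvt_partial G y1 i1 (p i1) (y i1)) as [t1 [Ht1 M1]];
    [intros; apply Hd; now apply B1 |].
  destruct (mvt_partial G y2 i2 (p i2) (y i2)) as [t2 [Ht2 M2]];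
    [intros; apply Hd; now apply B2 |].
  rewrite E0 in M0; rewrite E1 in M1; rewrite E2, E3 in M2.
  fold y1 in M0; fold y2 in M1.
  destruct (Hd _ (B0 t0 Ht0)) as [_ A0]; specialize (A0 i0).
  destruct (Hd _ (B1 t1 Ht1)) as [_ A1]; specialize (A1 i1).
  destruct (Hd _ (B2 t2 Ht2)) as [_ A2]; specialize (A2 i2).
  unfold sum3.
  set (q0 := partial i0 G (upd p i0 t0)) in *.
  set (q1 := partial i1 G (upd y1 i1 t1)) in *.
  set (q2 := partial i2 G (upd y2 i2 t2)) in *.
  replace (G y - G p - _) with
    ((q0 - partial i0 G p) * (y i0 - p i0) + (q1 - partial i1 G p) * (y i1 - p i1)
     + (q2 - partial i2 G p) * (y i2 - p i2)) by lra.
  eapply Rle_trans; [apply Rabs_triang |]. rewrite !Rmult_plus_distr_l.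
  apply Rplus_le_compat; [eapply Rle_trans; [apply Rabs_triang |]; apply Rplus_le_compat |];
    rewrite Rabs_mult; apply Rmult_le_compat_r; try apply Rabs_pos; now apply Rlt_le.
Qed.

Lemma is_derive_sum3 (h : ix -> R -> R) (z : R) (dh : ix -> R) :
  (forall i, is_derive (h i) z (dh i)) ->
  is_derive (fun z => sum3 (fun i => h i z)) z (sum3 dh).
Proof.
  intros H. unfold sum3.
  apply (is_derive_plus (K := R_AbsRing) (V := R_NormedModule) (fun z => h i0 z + h i1 z) (h i2));
    [| apply H].
  apply (is_derive_plus (K := R_AbsRing) (V := R_NormedModule) (h i0) (h i1)); apply H.
Qed.

(** After the linearization [L] of [G] at [p] is subtracted, the remainder is of smaller order than
    [x z - p], hence than [z - z0] by a Lipschitz bound on [x] at [z0]; its derivative is therefore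
    0. *)
Lemma chain_rule_vec (G : vec -> R) (x : R -> vec) (dx : vec) (z0 : R) :
  locally (x z0) (fun y => forall i, ex_partial i G y) ->
  (forall i, continuous (partial i G) (x z0)) ->
  (forall i, is_derive (fun z => x z i) z0 (dx i)) ->
  is_derive (fun z => G (x z)) z0 (sum3 (fun i => partial i G (x z0) * dx i)).
Proof.
  intros HG Hc Hx. set (p := x z0) in *.
  set (L := fun z => sum3 (fun i => partial i G p * x z i)).
  assert (HL : is_derive L z0 (sum3 (fun i => partial i G p * dx i))).
  { apply (is_derive_sum3 (fun i z => partial i G p * x z i)); intros i.
    apply (is_derive_scal (fun z => x z i)), Hx. }
  assert (HR : is_derive (fun z => G (x z) - L z) z0 0).
  { apply is_derive_0_intro; intros eps.
    set (M := sum3 (fun i => Rabs (dx i) + 1)).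
    assert (HM : 0 < M).
    { unfold M, sum3; generalize (Rabs_pos (dx i0)) (Rabs_pos (dx i1)) (Rabs_pos (dx i2)); lra. }
    assert (He : 0 < eps / M) by (apply Rdiv_lt_0_compat; [apply cond_pos | assumption]).
    (* The extra 1 is the error allowed in the definition of the derivative of each coordinate. *)
    assert (Lip : locally z0 (fun z => forall i, Rabs (x z i - p i) <= (Rabs (dx i) + 1) * Rabs (z - z0))).
    { assert (Lip1 : forall i, locally z0 (fun z => Rabs (x z i - p i) <= (Rabs (dx i) + 1) * Rabs (z - z0))).
      { intros i. destruct (Hx i) as [_ Hi].
        generalize (Hi z0 (fun P H => H) (mkposreal 1 Rlt_0_1)). apply filter_imp; intros z Hz.
        change (Rabs (x z i - p i - (z - z0) * dx i) <= 1 * Rabs (z - z0)) in Hz.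
        generalize (Rabs_triang (x z i - p i - (z - z0) * dx i) ((z - z0) * dx i)).
        rewrite Rabs_mult.
        replace (x z i - p i - (z - z0) * dx i + (z - z0) * dx i) with (x z i - p i) by ring.
        lra. }
      generalize (filter_and _ _ (Lip1 i0) (filter_and _ _ (Lip1 i1) (Lip1 i2))).
      apply filter_imp; intros z [? [? ?]] [| |]; assumption. }
    assert (Cx : filterlim x (locally z0) (locally p)).
    { apply filterlim_locally; intros d.
      assert (C1 : forall i, locally z0 (fun z => Rabs (x z i - p i) < d)).
      { intros i.
        apply (ex_derive_continuous (K := R_AbsRing) (V := R_NormedModule) (fun z => x z i) z0
                 (ex_intro _ _ (Hx i)) _ (locally_ball (x z0 i) d)). }
      generalize (filter_and _ _ (C1 i0) (filter_and _ _ (C1 i1) (C1 i2))).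
      apply filter_imp; intros z [? [? ?]] [| |]; assumption. }
    generalize (filter_and _ _ Lip (Cx _ (partial_linear_approx G p HG Hc (mkposreal _ He)))).
    apply filter_imp; intros z [Hz Ha]; simpl in Ha.
    replace (G (x z) - L z - (G (x z0) - L z0))
      with (G (x z) - G p - sum3 (fun i => partial i G p * (x z i - p i)))
      by (unfold L, sum3, p; ring).
    eapply Rle_trans; [apply Ha |].
    replace (eps * Rabs (z - z0)) with (eps / M * (M * Rabs (z - z0))) by (field; lra).
    apply Rmult_le_compat_l; [lra |].
    unfold M, sum3. generalize (Hz i0) (Hz i1) (Hz i2); lra. }
  apply (is_derive_ext (fun z => (G (x z) - L z) + L z)); [intros t; change (@eq R (G (x t) - L t + L t) (G (x t))); ring |].
  rewrite <- (Rplus_0_l (sum3 _)).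
  apply (is_derive_plus (K := R_AbsRing) (V := R_NormedModule)
           (fun z => G (x z) - L z) L); assumption.
Qed.

Lemma locally_nonzero (p : vec) :
  dot p p <> 0 -> locally p (fun y : vec => dot y y <> 0).
Proof.
  intros Hp.
  assert (Hk : exists k, p k <> 0).
  { destruct (Req_dec (p i0) 0); [| now exists i0].
    destruct (Req_dec (p i1) 0); [| now exists i1].
    destruct (Req_dec (p i2) 0); [| now exists i2].
    exfalso; apply Hp; unfold dot, sum3. rewrite H, H0, H1; ring. }
  destruct Hk as [k Hk].
  exists (mkposreal _ (Rabs_pos_lt _ Hk)); intros y Hy.
  assert (Hyk : Rabs (y k - p k) < Rabs (p k)) by apply (Hy k).
  assert (Hy0 : y k <> 0).
  { intros E; rewrite E in Hyk. unfold Rminus in Hyk; rewrite Rplus_0_l, Rabs_Ropp in Hyk; lra. }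
  assert (0 < y k * y k) by nra.
  unfold dot, sum3.
  assert (forall z, 0 <= z * z) by (intros; nra).
  generalize (H0 (y i0)) (H0 (y i1)) (H0 (y i2)); destruct k; lra.
Qed.

Definition e1v (s t : R) : vec := mkvec (cos s * cos t) (cos s * sin t) (- sin s).
Definition e2v (s t : R) : vec := mkvec (- sin t) (cos t) 0.

Lemma spherical_dot s t : dot (spherical s t) (spherical s t) = 1.
Proof.
  unfold dot, sum3; simpl. generalize (sin2_cos2 s) (sin2_cos2 t); unfold Rsqr; intros Hs Ht.
  transitivity (sin s * sin s * (sin t * sin t + cos t * cos t) + cos s * cos s); [ring |].
  now rewrite Ht, Rmult_1_r.
Qed.

Lemma hext_unit (phi : vec -> R) (x : vec) : dot x x = 1 -> hext phi x = phi x.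
Proof.
  intros H. unfold hext; f_equal. apply functional_extensionality; intros i.
  unfold enorm. rewrite H, sqrt_1. field.
Qed.

Lemma hext_scale (phi : vec -> R) (x : vec) (l : R) :
  0 < l -> hext phi (fun i => l * x i) = hext phi x.
Proof.
  intros Hl. unfold hext; f_equal. apply functional_extensionality; intros i.
  assert (E : enorm (fun i => l * x i) = l * enorm x).
  { unfold enorm. replace (dot (fun i => l * x i) (fun i => l * x i)) with (l ^ 2 * dot x x)
      by (unfold dot, sum3; ring).
    rewrite sqrt_mult_alt by apply pow2_ge_0. rewrite sqrt_pow2 by lra; reflexivity. }
  rewrite E. unfold Rdiv. rewrite Rinv_mult.
  replace (l * x i * (/ l * / enorm x)) with (l * / l * (x i * / enorm x)) by ring.
  rewrite Rinv_r by lra; ring.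
Qed.

Lemma spherical_s s t i : is_derive (fun z => spherical z t i) s (e1v s t i).
Proof. destruct i; simpl; auto_derive; trivial; ring. Qed.

Lemma spherical_t s t i : is_derive (fun z => spherical s z i) t (sin s * e2v s t i).
Proof. destruct i; simpl; auto_derive; trivial; ring. Qed.

Lemma C2D_spherical (G : vec -> R) :
  (forall s t, continuous G (spherical s t)) -> C2D (fun s t => G (spherical s t)).
Proof.
  intros H s t. apply continuity_2d_pt_filterlim.
  apply (filterlim_comp _ _ _ (fun z : R * R => spherical (fst z) (snd z)) G _
           (locally (spherical s t))); [| apply H].
  apply filterlim_locally; intros d.
  assert (Hi : forall i, locally (s, t)
    (fun z => Rabs (spherical (fst z) (snd z) i - spherical s t i) < d)).
  { intros i.
    assert (C : C2D (fun s t => spherical s t i)) by (destruct i; simpl; c2d).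
    specialize (C s t); apply continuity_2d_pt_filterlim in C.
    apply (C _ (locally_ball (spherical s t i) d)). }
  generalize (filter_and _ _ (Hi i0) (filter_and _ _ (Hi i1) (Hi i2))).
  apply filter_imp; intros z [? [? ?]] [| |]; assumption.
Qed.

Section Frame.

Variable phi : vec -> R.
Hypothesis Hphi : C2_sphere phi.

Let P (i : ix) (s t : R) : R := partial i (hext phi) (spherical s t).
Let H (i j : ix) (s t : R) : R := partial j (partial i (hext phi)) (spherical s t).

Definition fr_b1 s t : R := sum3 (fun i => P i s t * e1v s t i).
Definition fr_b2 s t : R := sum3 (fun i => P i s t * e2v s t i).
Definition fr_a11 s t : R := sum3 (fun i => sum3 (fun j => H i j s t * e1v s t j) * e1v s t i).
(** [fr_a12] and [fr_a21] are one Hessian entry with the two differentiations in opposite orders;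
    [fr_a_sym] compares them. *)
Definition fr_a12 s t : R := sum3 (fun i => sum3 (fun j => H i j s t * e1v s t j) * e2v s t i).
Definition fr_a21 s t : R := sum3 (fun i => sum3 (fun j => H i j s t * e2v s t j) * e1v s t i).
Definition fr_a22 s t : R := sum3 (fun i => sum3 (fun j => H i j s t * e2v s t j) * e2v s t i).

Lemma spherical_nonzero s t : dot (spherical s t) (spherical s t) <> 0.
Proof. rewrite spherical_dot; lra. Qed.

Lemma hext_chain (x : R -> vec) (dx : vec) (z0 s t : R) :
  x z0 = spherical s t -> (forall i, is_derive (fun z => x z i) z0 (dx i)) ->
  is_derive (fun z => hext phi (x z)) z0 (sum3 (fun i => P i s t * dx i)).
Proof.
  intros E Hx. unfold P; rewrite <- E. apply chain_rule_vec; [| | assumption].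
  - rewrite E. generalize (locally_nonzero _ (spherical_nonzero s t)).
    apply filter_imp; intros y Hy i. apply (Hphi y Hy i i).
  - rewrite E; intros i. apply (Hphi _ (spherical_nonzero s t) i i).
Qed.

Lemma partial_hext_chain (k : ix) (x : R -> vec) (dx : vec) (z0 s t : R) :
  x z0 = spherical s t -> (forall i, is_derive (fun z => x z i) z0 (dx i)) ->
  is_derive (fun z => partial k (hext phi) (x z)) z0 (sum3 (fun i => H k i s t * dx i)).
Proof.
  intros E Hx. unfold H; rewrite <- E. apply chain_rule_vec; [| | assumption].
  - rewrite E. generalize (locally_nonzero _ (spherical_nonzero s t)).
    apply filter_imp; intros y Hy i. apply (Hphi y Hy k i).
  - rewrite E; intros i. apply (Hphi _ (spherical_nonzero s t) k i).
Qed.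

(* Euler's relation for the 0-homogeneous extension. *)
Lemma hext_radial s t : sum3 (fun i => P i s t * spherical s t i) = 0.
Proof.
  assert (D := hext_chain (fun z i => z * spherical s t i) (spherical s t) 1 s t).
  assert (E1 : (fun i => 1 * spherical s t i) = spherical s t)
    by (apply functional_extensionality; intros; ring).
  specialize (D E1).
  assert (Di : forall i, is_derive (fun z => z * spherical s t i) 1 (spherical s t i))
    by (intros; auto_derive; trivial; ring).
  specialize (D Di).
  assert (D0 : is_derive (fun z => hext phi (fun i => z * spherical s t i)) 1 0).
  { apply (is_derive_ext_loc (fun _ => hext phi (spherical s t))).
    - generalize (open_gt 0 1 Rlt_0_1). apply filter_imp; intros z Hz.
      symmetry; now apply hext_scale.
    - apply (is_derive_const (K := R_AbsRing) (V := R_NormedModule)). }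
  apply is_derive_unique in D; apply is_derive_unique in D0. congruence.
Qed.

Lemma C2D_P i : C2D (P i).
Proof. apply C2D_spherical; intros s t; apply (Hphi _ (spherical_nonzero s t) i i). Qed.

Lemma C2D_H i j : C2D (H i j).
Proof. apply C2D_spherical; intros s t; apply (Hphi _ (spherical_nonzero s t) i j). Qed.

Lemma P_s i s t : is_derive (fun z => P i z t) s (sum3 (fun j => H i j s t * e1v s t j)).
Proof. apply (partial_hext_chain i (fun z => spherical z t)); [easy | intros; apply spherical_s]. Qed.

Lemma P_t i s t :
  is_derive (fun z => P i s z) t (sin s * sum3 (fun j => H i j s t * e2v s t j)).
Proof.
  replace (sin s * sum3 _) with (sum3 (fun j => H i j s t * (sin s * e2v s t j)))
    by (unfold sum3; ring).
  apply (partial_hext_chain i (fun z => spherical s z)); [easy | intros; apply spherical_t].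
Qed.

Lemma frame_derive (Q e : ix -> R -> R) (dQ de : ix -> R) (z : R) :
  (forall i, is_derive (Q i) z (dQ i)) -> (forall i, is_derive (e i) z (de i)) ->
  is_derive (fun z => sum3 (fun i => Q i z * e i z)) z
    (sum3 (fun i => dQ i * e i z) + sum3 (fun i => Q i z * de i)).
Proof.
  intros HQ He.
  replace (_ + _) with (sum3 (fun i => dQ i * e i z + Q i z * de i)) by (unfold sum3; ring).
  apply (is_derive_sum3 (fun i z => Q i z * e i z)); intros i.
  apply (is_derive_mult (K := R_AbsRing) (Q i) (e i)); [apply HQ | apply He | apply Rmult_comm].
Qed.

Lemma fr_s s t : is_derive (fun z => hext phi (spherical z t)) s (fr_b1 s t).
Proof. apply (hext_chain (fun z => spherical z t)); [easy | intros; apply spherical_s]. Qed.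

Lemma fr_t s t : is_derive (fun z => hext phi (spherical s z)) t (sin s * fr_b2 s t).
Proof.
  replace (sin s * fr_b2 s t) with (sum3 (fun j => P j s t * (sin s * e2v s t j)))
    by (unfold fr_b2, sum3; ring).
  apply (hext_chain (fun z => spherical s z)); [easy | intros; apply spherical_t].
Qed.

(** Along a meridian [e1v] has derivative [- spherical]. Euler's relation removes this radial
    contribution, which is why the Euclidean Hessian of the homogeneous extension gives the
    covariant one. *)
Lemma fr_1s s t : is_derive (fun z => fr_b1 z t) s (fr_a11 s t).
Proof.
  assert (De : forall i, is_derive (fun z => e1v z t i) s (- spherical s t i))
    by (intros [| |]; simpl; auto_derive; trivial; ring).
  assert (D := frame_derive (fun i z => P i z t) (fun i z => e1v z t i) _ _ s
                 (fun i => P_s i s t) De).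
  assert (E := hext_radial s t).
  replace (fr_a11 s t) with
    (fr_a11 s t + sum3 (fun i => P i s t * - spherical s t i)); [exact D |].
  revert E; unfold sum3; lra.
Qed.

Lemma fr_2s s t : is_derive (fun z => fr_b2 z t) s (fr_a12 s t).
Proof.
  assert (De : forall i, is_derive (fun z => e2v z t i) s 0)
    by (intros [| |]; simpl; apply (is_derive_const (K := R_AbsRing) (V := R_NormedModule))).
  assert (D := frame_derive (fun i z => P i z t) (fun i z => e2v z t i) _ _ s
                 (fun i => P_s i s t) De).
  replace (fr_a12 s t) with (fr_a12 s t + sum3 (fun i => P i s t * 0)); [exact D |].
  unfold sum3; lra.
Qed.

Lemma fr_1t s t : is_derive (fun z => fr_b1 s z) t (sin s * fr_a21 s t + cos s * fr_b2 s t).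
Proof.
  assert (De : forall i, is_derive (fun z => e1v s z i) t (cos s * e2v s t i))
    by (intros [| |]; simpl; auto_derive; trivial; ring).
  assert (D := frame_derive (fun i z => P i s z) (fun i z => e1v s z i) _ _ t
                 (fun i => P_t i s t) De).
  replace (_ + _) with
    (sum3 (fun i => sin s * sum3 (fun j => H i j s t * e2v s t j) * e1v s t i)
     + sum3 (fun i => P i s t * (cos s * e2v s t i))); [exact D |].
  unfold fr_a21, fr_b2, sum3; ring.
Qed.

Lemma fr_2t s t : is_derive (fun z => fr_b2 s z) t (sin s * fr_a22 s t - cos s * fr_b1 s t).
Proof.
  (* The derivative is the inward horizontal unit vector, split into its radial part, which Euler's
     relation removes, and its part along [e1v], which is the connection term. *)
  assert (De : forall i, is_derive (fun z => e2v s z i) t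
      (- sin s * spherical s t i - cos s * e1v s t i)).
  { generalize (sin2_cos2 s); unfold Rsqr; intros Hsc.
    intros [| |]; simpl; auto_derive; trivial; try ring.
    - transitivity (- (sin s * sin s + cos s * cos s) * cos t); [rewrite Hsc |]; ring.
    - transitivity (- (sin s * sin s + cos s * cos s) * sin t); [rewrite Hsc |]; ring. }
  assert (D := frame_derive (fun i z => P i s z) (fun i z => e2v s z i) _ _ t
                 (fun i => P_t i s t) De).
  assert (E := hext_radial s t).
  replace (_ - _) with
    (sum3 (fun i => sin s * sum3 (fun j => H i j s t * e2v s t j) * e2v s t i)
     + sum3 (fun i => P i s t * (- sin s * spherical s t i - cos s * e1v s t i))); [exact D |].
  transitivity (sin s * fr_a22 s t - cos s * fr_b1 s t
      - sin s * sum3 (fun i => P i s t * spherical s t i)).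
  - unfold fr_a22, fr_b1, sum3; ring.
  - rewrite E; ring.
Qed.

Lemma C2D_frame : C2D fr_b1 /\ C2D fr_b2 /\ C2D fr_a11 /\ C2D fr_a12 /\ C2D fr_a21 /\ C2D fr_a22.
Proof.
  assert (CP := C2D_P); assert (CH := C2D_H).
  assert (Ce1 : forall i, C2D (fun s t => e1v s t i)) by (intros [| |]; simpl; c2d).
  assert (Ce2 : forall i, C2D (fun s t => e2v s t i)) by (intros [| |]; simpl; c2d).
  assert (CP' : forall i, C2D (fun s t => P i s t)) by exact CP.
  assert (CH' : forall i j, C2D (fun s t => H i j s t)) by exact CH.
  unfold fr_b1, fr_b2, fr_a11, fr_a12, fr_a21, fr_a22, sum3.
  clearbody P H.
  repeat split;
    repeat first [ apply CP' | apply CH' | apply Ce1 | apply Ce2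
                 | apply C2D_plus | apply C2D_mult ].
Qed.

(** [C2_sphere] speaks of continuity of derivatives only. Continuity of the function follows from
    differentiability in [(s, t)], for which the continuity of [fr_b1] and a derivative in [t]
    suffice. *)
Lemma C2D_hext : C2D (fun s t => hext phi (spherical s t)).
Proof.
  intros s t. apply continuity_2d_pt_filterlim.
  apply (filterdiff_continuous (K := R_AbsRing)
           (U := prod_NormedModule R_AbsRing R_NormedModule R_NormedModule) (V := R_NormedModule)
           (fun z => hext phi (spherical (fst z) (snd z))) (s, t)).
  eexists. apply (is_derive_filterdiff (fun s t => hext phi (spherical s t)) s t fr_b1).
  - apply filter_forall; intros; apply fr_s.
  - apply fr_t.
  - apply (continuity_2d_pt_filterlim fr_b1), C2D_frame.
Qed.

(** Schwarz's theorem in the coordinates [(s, t)]; the terms [cos s * fr_b2] cancel. The factor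
    [sin s] cannot be divided out at the poles, but [sf_1t] contains the mixed entry with exactly
    this factor. *)
Lemma fr_a_sym s t : sin s * fr_a12 s t = sin s * fr_a21 s t.
Proof.
  destruct C2D_frame as [C1 [C2 [C11 [C12 [C21 C22]]]]].
  assert (Dt : forall s t, Derive (fun z => hext phi (spherical s z)) t = sin s * fr_b2 s t)
    by (intros; apply is_derive_unique, fr_t).
  assert (Ds : forall s t, Derive (fun z => hext phi (spherical z t)) s = fr_b1 s t)
    by (intros; apply is_derive_unique, fr_s).
  assert (Dst : forall s t, is_derive (fun z => Derive (fun y => hext phi (spherical z y)) t) s
                 (cos s * fr_b2 s t + sin s * fr_a12 s t)).
  { intros x y. apply (is_derive_ext (fun z => sin z * fr_b2 z y)); [intros; now rewrite Dt |].
    assert (X := fr_2s x y). auto_derive; [eexists; apply X | dsub; ring]. }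
  assert (Dts : forall s t, is_derive (fun z => Derive (fun x => hext phi (spherical x z)) s) t
                 (sin s * fr_a21 s t + cos s * fr_b2 s t)).
  { intros x y. apply (is_derive_ext (fun z => fr_b1 x z)); [intros; now rewrite Ds |].
    apply fr_1t. }
  assert (S := Schwarz (fun s t => hext phi (spherical s t)) s t).
  assert (Est : Derive (fun z : R => Derive (fun y : R => hext phi (spherical z y)) t) s
                = cos s * fr_b2 s t + sin s * fr_a12 s t) by apply is_derive_unique, Dst.
  assert (Ets : Derive (fun z : R => Derive (fun x : R => hext phi (spherical x z)) s) t
                = sin s * fr_a21 s t + cos s * fr_b2 s t) by apply is_derive_unique, Dts.
  cbv beta in S; rewrite Est, Ets in S.
  enough (cos s * fr_b2 s t + sin s * fr_a12 s t = sin s * fr_a21 s t + cos s * fr_b2 s t) by lra.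
  apply S.
  - apply locally_2d_forall; intros x y; repeat split; eexists;
      [apply fr_s | apply fr_t | apply Dst | apply Dts].
  - apply continuity_2d_pt_ext with (fun s t => cos s * fr_b2 s t + sin s * fr_a12 s t).
    + intros x y; symmetry; apply is_derive_unique, Dst.
    + assert (C : C2D (fun s t => cos s * fr_b2 s t + sin s * fr_a12 s t)) by c2d. apply C.
  - apply continuity_2d_pt_ext with (fun s t => sin s * fr_a21 s t + cos s * fr_b2 s t).
    + intros x y; symmetry; apply is_derive_unique, Dts.
    + assert (C : C2D (fun s t => sin s * fr_a21 s t + cos s * fr_b2 s t)) by c2d. apply C.
Qed.

Lemma is_derive_add_const (c : R) (h : R -> R) (x l : R) :
  is_derive h x l -> is_derive (fun z => c + h z) x l.
Proof. intros Hh. auto_derive; [now exists l | dsub; ring]. Qed.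

Lemma spherical_periodic s t : spherical s (t + 2 * PI) = spherical s t.
Proof.
  unfold spherical. now rewrite sin_plus, cos_plus, sin_2PI, cos_2PI, !Rmult_0_r, !Rmult_1_r,
    Rminus_0_r, Rplus_0_r.
Qed.

Lemma sphere_frame_of_C2 (r : R) :
  sphere_frame (fun s t => r + phi (spherical s t)) fr_b1 fr_b2 fr_a11 fr_a12 fr_a22.
Proof.
  replace (fun s t => r + phi (spherical s t)) with (fun s t => r + hext phi (spherical s t))
    by (do 2 (apply functional_extensionality; intro);
        now rewrite hext_unit by apply spherical_dot).
  destruct C2D_frame as [C1 [C2 [C11 [C12 [C21 C22]]]]].
  assert (Ch := C2D_hext).
  assert (Pv : forall s t, e1v s (t + 2 * PI) = e1v s t /\ e2v s (t + 2 * PI) = e2v s t).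
  { intros s t; unfold e1v, e2v.
    now rewrite !sin_plus, !cos_plus, sin_2PI, cos_2PI, !Rmult_0_r, !Rmult_1_r,
      Rminus_0_r, Rplus_0_r. }
  split; try assumption; try apply C2D_plus; try apply C2D_const; try assumption;
    intros s t.
  - apply (is_derive_add_const r (fun z => hext phi (spherical z t))), fr_s.
  - apply (is_derive_add_const r (fun z => hext phi (spherical s z))), fr_t.
  - apply fr_1s.
  - rewrite fr_a_sym; apply fr_1t.
  - apply fr_2s.
  - apply fr_2t.
  - now rewrite spherical_periodic.
  - unfold fr_b1, P. rewrite spherical_periodic. now destruct (Pv s t) as [-> _].
  - unfold fr_b2, P. rewrite spherical_periodic. now destruct (Pv s t) as [_ ->].
Qed.

(** In fact an equality: [e1v], [e2v] and [spherical] are an orthonormal basis, and the radial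
    component of the gradient is 0 by Euler's relation. *)
Lemma frame_grad_norm s t :
  fr_b1 s t ^ 2 + fr_b2 s t ^ 2 <= enorm (sphere_grad phi (spherical s t)) ^ 2.
Proof.
  unfold enorm. rewrite pow2_sqrt.
  2:{ unfold dot, sum3; generalize (fun z : R => Rle_0_sqr z); unfold Rsqr; intros X.
      repeat apply Rplus_le_le_0_compat; apply X. }
  assert (E := hext_radial s t).
  apply Rle_trans with (fr_b1 s t ^ 2 + fr_b2 s t ^ 2
                        + (sum3 (fun i => P i s t * spherical s t i)) ^ 2);
    [rewrite E; lra | right].
  unfold fr_b1, fr_b2, dot, sum3, sphere_grad; unfold P; simpl spherical; simpl e1v; simpl e2v.
  cbn [mkvec e1v e2v].
  set (p := partial i0 (hext phi) (spherical s t)). set (q := partial i1 (hext phi) (spherical s t)).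
  set (w := partial i2 (hext phi) (spherical s t)). clearbody p q w.
  assert (Hs : cos s ^ 2 = 1 - sin s ^ 2) by (generalize (sin2_cos2 s); unfold Rsqr; lra).
  assert (Ht : cos t ^ 2 = 1 - sin t ^ 2) by (generalize (sin2_cos2 t); unfold Rsqr; lra).
  transitivity ((p * cos t + q * sin t) ^ 2 * (cos s ^ 2 + sin s ^ 2) + (q * cos t - p * sin t) ^ 2
     + w ^ 2 * (cos s ^ 2 + sin s ^ 2)); [unfold e1v, e2v, spherical, mkvec; ring |].
  rewrite Hs. transitivity ((p ^ 2 + q ^ 2) * (cos t ^ 2 + sin t ^ 2) + w ^ 2); [ring |].
  rewrite Ht; ring.
Qed.

End Frame.

(** * Consequences of a small C^2 norm *)

Lemma sup_S2_bound (h : vec -> R) (x : vec) : S2 x -> Rbar_le (h x) (sup_S2 h).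
Proof.
  intros Hx. unfold sup_S2.
  destruct (Lub_Rbar_correct (fun y => exists x, S2 x /\ y = h x)) as [Hub _].
  apply Hub; now exists x.
Qed.

Lemma C2_norm_lt (rho eps : R) (phi : vec -> R) (x : vec) :
  0 < rho -> Rbar_lt (C2_norm rho phi) eps -> S2 x ->
  Rabs (phi x) < eps /\ enorm (sphere_grad phi x) < rho * eps.
Proof.
  intros Hrho Hn Hx. unfold C2_norm in Hn.
  assert (A := sup_S2_bound (fun x => Rabs (phi x)) x Hx).
  assert (B := sup_S2_bound (fun x => enorm (sphere_grad phi x) / rho) x Hx).
  assert (C := sup_S2_bound (fun x => mat_norm (sphere_hess phi x) / rho ^ 2) x Hx).
  assert (A0 := Rabs_pos (phi x)).
  assert (B0 : 0 <= enorm (sphere_grad phi x) / rho)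
    by (apply Rdiv_le_0_compat; [apply sqrt_pos | assumption]).
  assert (C0 : 0 <= mat_norm (sphere_hess phi x) / rho ^ 2)
    by (apply Rdiv_le_0_compat; [apply sqrt_pos | now apply pow_lt]).
  cbv beta in A, B, C.
  set (vb := enorm (sphere_grad phi x) / rho) in *.
  set (vc := mat_norm (sphere_hess phi x) / rho ^ 2) in *.
  (* Each supremum dominates a real number and their sum is below one, so only the case of three
     finite values survives. *)
  destruct (sup_S2 (fun x => Rabs (phi x))) as [a| |]; try contradiction;
  destruct (sup_S2 (fun x => enorm (sphere_grad phi x) / rho)) as [b| |]; try contradiction;
  destruct (sup_S2 (fun x => mat_norm (sphere_hess phi x) / rho ^ 2)) as [c| |]; try contradiction;
  simpl in Hn; try contradiction.
  simpl in A, B, C.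
  split; [lra |].
  apply Rmult_lt_reg_l with (/ rho); [now apply Rinv_0_lt_compat |].
  rewrite <- Rmult_assoc, Rinv_l, Rmult_1_l by lra. unfold vb, Rdiv in B, B0; lra.
Qed.

(** The longitude [acos (x i0 / rho)] fixes [x i1] up to sign, and negating it changes that sign; at
    the poles, where [rho] is 0, any longitude will do. This carries constancy in the coordinates
    over to the sphere. *)
Lemma spherical_onto (x : vec) : S2 x -> exists s t, 0 <= s <= PI /\ x = spherical s t.
Proof.
  unfold S2, dot, sum3; intros Hx.
  assert (Hz : -1 <= x i2 <= 1) by nra.
  exists (acos (x i2)).
  assert (Hs := acos_bound (x i2)).
  assert (Hc : cos (acos (x i2)) = x i2) by now apply cos_acos.
  assert (Hsin : sin (acos (x i2)) ^ 2 = x i0 ^ 2 + x i1 ^ 2).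
  { generalize (sin2_cos2 (acos (x i2))); unfold Rsqr; rewrite Hc; lra. }
  set (rho := sin (acos (x i2))) in *.
  assert (Hrho : 0 <= rho) by (apply sin_ge_0; apply Hs).
  destruct (Req_dec rho 0) as [E | E].
  - exists 0; split; [assumption |].
    rewrite E in Hsin.
    apply functional_extensionality; intros [| |]; simpl; fold rho; rewrite ?E, ?Hc; nra.
  - assert (Hw : -1 <= x i0 / rho <= 1).
    { assert (x i0 ^ 2 <= rho ^ 2) by (rewrite Hsin; generalize (pow2_ge_0 (x i1)); lra).
      assert (Hab : - rho <= x i0 <= rho) by nra.
      split; [apply Rmult_le_reg_r with rho; [lra |] | apply Rmult_le_reg_r with rho; [lra |]];
        unfold Rdiv; rewrite Rmult_assoc, Rinv_l by assumption; lra. }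
    assert (Hct : cos (acos (x i0 / rho)) = x i0 / rho) by now apply cos_acos.
    assert (Hst : (rho * sin (acos (x i0 / rho))) ^ 2 = x i1 ^ 2).
    { replace (x i1 ^ 2) with (rho ^ 2 - x i0 ^ 2) by lra.
      replace ((rho * sin (acos (x i0 / rho))) ^ 2)
        with (rho ^ 2 - (rho * cos (acos (x i0 / rho))) ^ 2).
      - rewrite Hct; field; assumption.
      - generalize (sin2_cos2 (acos (x i0 / rho))); unfold Rsqr; intros Hsc.
        transitivity (rho ^ 2 * (1 - cos (acos (x i0 / rho)) * cos (acos (x i0 / rho)))); [ring |].
        rewrite <- Hsc; ring. }
    assert (Hy : x i1 = rho * sin (acos (x i0 / rho)) \/ x i1 = - (rho * sin (acos (x i0 / rho)))).
    { assert (X : (x i1 - rho * sin (acos (x i0 / rho))) * (x i1 + rho * sin (acos (x i0 / rho))) = 0)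
        by (ring_simplify; rewrite <- Hst; ring).
      apply Rmult_integral in X; destruct X; [left | right]; lra. }
    assert (Hx0 : x i0 = rho * (x i0 / rho)) by (field; assumption).
    destruct Hy as [Hy | Hy];
      [exists (acos (x i0 / rho)) | exists (- acos (x i0 / rho))]; (split; [assumption |]);
      apply functional_extensionality; intros [| |]; simpl; fold rho;
      rewrite ?sin_neg, ?cos_neg, ?Hct; lra.
Qed.

(** * The Hawking mass of a graph *)

Definition avg (g : R -> R -> R) : R := sint (fun s t => sin s * g s t) / (4 * PI).

Lemma avg_ext f g : (forall s t, f s t = g s t) -> avg f = avg g.
Proof. intros H; unfold avg; f_equal; apply sint_ext; intros; now rewrite H. Qed.

Lemma avg_plus f g : C2D f -> C2D g -> avg (fun s t => f s t + g s t) = avg f + avg g.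
Proof.
  intros Hf Hg. unfold avg. rewrite <- Rdiv_plus_distr, <- sint_plus by c2d.
  f_equal; apply sint_ext; intros; ring.
Qed.

Lemma avg_scal c f : C2D f -> avg (fun s t => c * f s t) = c * avg f.
Proof.
  intros Hf. unfold avg, Rdiv. rewrite <- Rmult_assoc, <- sint_scal by c2d.
  f_equal; apply sint_ext; intros; ring.
Qed.

Lemma avg_minus f g : C2D f -> C2D g -> avg (fun s t => f s t - g s t) = avg f - avg g.
Proof.
  intros Hf Hg.
  rewrite (avg_ext _ (fun s t => f s t + (-1) * g s t)) by (intros; ring).
  rewrite avg_plus, avg_scal by c2d; ring.
Qed.

Lemma avg_const c : avg (fun _ _ => c) = c.
Proof.
  unfold avg. rewrite (sint_ext _ (fun s _ => c * sin s)) by (intros; ring).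
  rewrite sint_scal, sint_sin by c2d. field. generalize PI_RGT_0; lra.
Qed.

Lemma avg_le f g : C2D f -> C2D g -> (forall s t, f s t <= g s t) -> avg f <= avg g.
Proof.
  intros Hf Hg H. unfold avg, Rdiv. generalize PI_RGT_0; intros Hpi.
  apply Rmult_le_compat_r; [left; apply Rinv_0_lt_compat; lra |].
  apply sint_le; try c2d. intros s t Hs.
  apply Rmult_le_compat_l; [left; now apply sin_gt_0 | apply H].
Qed.

Lemma avg_ge_0 f : C2D f -> (forall s t, 0 <= f s t) -> 0 <= avg f.
Proof. intros Hf H. rewrite <- (avg_const 0). apply avg_le; [c2d | assumption | assumption]. Qed.

Lemma avg_poincare (h c1 c2 : R -> R -> R) :
  (forall s t, is_derive (fun z => h z t) s (c1 s t)) ->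
  (forall s t, is_derive (fun z => h s z) t (sin s * c2 s t)) ->
  C2D h -> C2D c1 -> C2D c2 ->
  (forall s t, h s (t + 2 * PI) = h s t) -> (forall s t, c2 s (t + 2 * PI) = c2 s t) ->
  2 * avg (fun s t => (h s t - avg h) ^ 2) <= avg (fun s t => c1 s t ^ 2 + c2 s t ^ 2).
Proof.
  intros Hs Ht Ch Cc1 Cc2 Ph Pc2; generalize PI_RGT_0; intros Hpi.
  unfold avg at 1 3, Rdiv. rewrite <- Rmult_assoc.
  apply Rmult_le_compat_r; [left; apply Rinv_0_lt_compat; lra |].
  apply poincare; try assumption. unfold avg; field; lra.
Qed.

(** * Nonnegative functions with zero average *)

Lemma RInt_eq_0 (h : R -> R) (a b x : R) :
  C1D h -> (forall y, a <= y <= b -> 0 <= h y) -> RInt h a b = 0 ->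
  a < b -> a <= x <= b -> h x = 0.
Proof.
  intros Ch Hp H0 Hab Hx.
  destruct (Rle_lt_or_eq_dec _ _ (Hp x Hx)) as [Hlt | Heq]; [exfalso | now symmetry].
  destruct (Ch x _ (open_gt 0 (h x) Hlt)) as [d Hd].
  set (y1 := Rmax a (x - d / 2)). set (y2 := Rmin b (x + d / 2)).
  assert (Hdp := cond_pos d).
  assert (Hy : a <= y1 /\ y1 < y2 /\ y2 <= b /\ x - d / 2 <= y1 /\ y2 <= x + d / 2).
  { unfold y1, y2, Rmax, Rmin. destruct (Rle_dec a _); destruct (Rle_dec b _); lra. }
  assert (P1 : 0 <= RInt h a y1)
    by (apply RInt_ge_0; [lra | now apply C1D_ex_RInt | intros; apply Hp; lra]).
  assert (P3 : 0 <= RInt h y2 b)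
    by (apply RInt_ge_0; [lra | now apply C1D_ex_RInt | intros; apply Hp; lra]).
  assert (P2 : 0 < RInt h y1 y2).
  { apply RInt_gt_0; [lra | | intros; apply Ch].
    intros y Hy'. apply Hd. change (Rabs (y - x) < d). apply Rabs_def1; lra. }
  generalize (RInt_split h a y1 b Ch) (RInt_split h y1 y2 b Ch); lra.
Qed.

Lemma avg_eq_0 (g : R -> R -> R) :
  C2D g -> (forall s t, 0 <= g s t) -> (forall s t, g s (t + 2 * PI) = g s t) ->
  avg g = 0 -> forall s t, 0 <= s <= PI -> g s t = 0.
Proof.
  intros Cg Hg Pg H0; generalize PI_RGT_0; intros Hpi.
  assert (Hc : forall s, 0 <= circ (g s)).
  { intros s. apply RInt_ge_0; [lra | now apply C1D_ex_RInt, C2D_section | intros; apply Hg]. }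
  assert (Hi : forall s t, 0 < s < PI -> g s t = 0).
  { intros s t Hs.
    assert (Ccirc : C1D (fun s => circ (g s))) by now apply circ_C1D.
    assert (Z : sin s * circ (g s) = 0).
    { apply (RInt_eq_0 (fun s => sin s * circ (g s)) 0 PI); try lra.
      - set (k := fun s => circ (g s)) in *. change (C1D (fun s => sin s * k s)). c2d.
      - intros y Hy; apply Rmult_le_pos; [now apply sin_ge_0 | apply Hc].
      - unfold avg, Rdiv in H0. apply Rmult_integral in H0.
        destruct H0 as [H0 | H0]; [| exfalso; revert H0; apply Rinv_neq_0_compat; lra].
        transitivity (sint (fun s t => sin s * g s t)); [| exact H0].
        apply RInt_real_ext; intros x _. symmetry.
        apply circ_scal, (C2D_section g Cg). }
    assert (0 < sin s) by (apply sin_gt_0; lra).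
    apply Rmult_integral in Z; destruct Z as [Z | Z]; [lra |].
    (* Starting the period at [t] places an arbitrary longitude inside the interval of
       integration. *)
    rewrite <- (circ_shift (g s) t) in Z by (try apply Pg; apply (C2D_section g Cg)).
    apply (RInt_eq_0 (g s) t (t + 2 * PI)); try lra.
    - apply (C2D_section g Cg).
    - intros; apply Hg. }
  intros s t Hs.
  (* The weight [sin s] hides the poles from the average; there [g] is 0 by continuity, being 0
     along the open meridian. *)
  apply (RInt_eq_0 (fun s => g s t) 0 PI); try lra.
  - intros x. apply (C1D_of_C2D (fun z => g z t)). intros y z.
    apply continuity_2d_pt_filterlim.
    assert (X := proj1 (continuity_2d_pt_filterlim g z t) (Cg z t)).
    apply (filterlim_comp _ _ _ (fun p : R * R => (snd p, t)) (fun p : R * R => g (fst p) (snd p))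
             _ (locally (z, t))); [| exact X].
    intros Q [d Hd]. exists d; intros p [_ Hp2]. apply Hd; split; [exact Hp2 | apply ball_center].
  - intros; apply Hg.
  - rewrite (RInt_real_ext _ (fun _ => 0)).
    + rewrite RInt_const. apply Rmult_0_r.
    + rewrite Rmin_left, Rmax_right by lra. intros; now apply Hi.
Qed.

(** Along a meridian [f] has derivative [b1 = 0], which leads to the pole [s = 0]; there the factor
    [sin 0] kills the derivative in [t]. *)
Lemma frame_constant (f b1 b2 a11 a12 a22 : R -> R -> R) :
  sphere_frame f b1 b2 a11 a12 a22 -> avg (gq b1 b2) = 0 ->
  forall s t, 0 <= s <= PI -> f s t = f 0 0.
Proof.
  intros Hf H0 s t Hs.
  assert (C1 := sf_C1 _ _ _ _ _ _ Hf). assert (C2 := sf_C2 _ _ _ _ _ _ Hf).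
  assert (Z : forall s t, 0 <= s <= PI -> gq b1 b2 s t = 0).
  { apply avg_eq_0; try assumption.
    - unfold gq; c2d.
    - intros; apply gq_pos.
    - intros; unfold gq. now rewrite (sf_P1 _ _ _ _ _ _ Hf), (sf_P2 _ _ _ _ _ _ Hf). }
  assert (Z1 : forall s t, 0 <= s <= PI -> b1 s t = 0).
  { intros x y Hx. generalize (Z x y Hx); unfold gq.
    generalize (pow2_ge_0 (b1 x y)) (pow2_ge_0 (b2 x y)); nra. }
  transitivity (f 0 t).
  - destruct (Req_dec s 0) as [-> | Hs0]; [reflexivity |].
    symmetry; apply (eq_is_derive (fun z => f z t)); [| lra].
    intros z Hz. generalize (sf_s _ _ _ _ _ _ Hf z t). now rewrite Z1 by lra.
  - assert (D : forall z, is_derive (f 0) z 0).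
    { intros z. generalize (sf_t _ _ _ _ _ _ Hf 0 z). now rewrite sin_0, Rmult_0_l. }
    destruct (Rtotal_order t 0) as [Ht | [-> | Ht]]; [| reflexivity |].
    + apply (eq_is_derive (f 0)); [intros; apply D | assumption].
    + symmetry; apply (eq_is_derive (f 0)); [intros; apply D | assumption].
Qed.

(** * The numerical inequality behind the mass comparison *)

(** In units of [u0]: [x] is the mean of v, [V] its variance, [P] the Dirichlet energy and [B] the
    averaged area density. The second order terms combine to [3/2 V - 3/4 P], at most
    [- 3/4 (1 - kappa) P], and smallness of [eta] keeps the errors below this gain. *)
Lemma normalized_mass_lt_1 (x V P kappa c eta B : R) :
  0 < eta <= / 20 -> 1 - eta <= x <= 1 + eta -> 0 <= V -> 2 * V <= kappa * P -> 0 < P ->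
  0 <= kappa < 1 -> 0 <= c -> (9 + c) * eta <= (1 - kappa) / 2 ->
  0 <= B <= x ^ 2 + V + P / 2 ->
  sqrt B * (/ x + (1 + 4 * eta) * V - (1 - 4 * eta) * P + c * eta * P) < 1.
Proof.
  intros He Hx HV HVP HP Hk Hc Hs HB.
  set (Y := / x + (1 + 4 * eta) * V - (1 - 4 * eta) * P + c * eta * P).
  destruct (Rle_lt_dec Y 0) as [HY | HY].
  { generalize (sqrt_pos B); intros; nra. }
  assert (Hx0 : 0 < x) by lra.
  (* [al] comes from [sqrt B <= x + (V + P / 2) / (2 x)] and [V <= kappa P / 2]. In [be] the 6
     collects [4 eta P] from the coefficient of [P] and [2 kappa eta P <= 2 eta P] from that of
     [V]. *)
  set (al := (1 + kappa) / 4). set (be := 1 - kappa / 2 - (6 + c) * eta).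
  assert (Hsq : sqrt B <= x + al * P / x).
  { assert (0 <= al * P / x).
    { unfold al; apply Rdiv_le_0_compat; [apply Rmult_le_pos |]; lra. }
    apply Rsqr_incr_0_var; [| lra]. rewrite Rsqr_sqrt, Rsqr_pow2 by lra.
    replace ((x + al * P / x) ^ 2) with (x ^ 2 + 2 * al * P + (al * P / x) ^ 2) by (field; lra).
    generalize (pow2_ge_0 (al * P / x)); unfold al; nra. }
  assert (HYb : Y <= / x - be * P).
  { unfold Y, be.
    assert ((1 + 4 * eta) * (2 * V) <= (1 + 4 * eta) * (kappa * P)) by (apply Rmult_le_compat_l; lra).
    assert (0 <= eta * P * (1 - kappa)) by (repeat apply Rmult_le_pos; lra).
    lra. }
  apply Rle_lt_trans with ((x + al * P / x) * (/ x - be * P)).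
  { apply Rmult_le_compat; try assumption; [apply sqrt_pos | lra]. }
  assert (Hce : 0 <= c * eta) by (apply Rmult_le_pos; lra).
  assert (Hbe : 0 < be) by (unfold be; lra).
  (* Replacing [x ^ 3] by 1 costs [3 eta], hence the 9 in the hypothesis: [be - 3 eta = 1 - kappa /
     2 - (9 + c) eta >= 1 / 2 > al]. *)
  assert (Hx3 : al < x ^ 3 * be).
  { assert (A : (1 - 3 * eta) <= x ^ 3).
    { apply Rle_trans with ((1 - eta) ^ 3); [nra | apply pow_incr; lra]. }
    apply Rlt_le_trans with ((1 - 3 * eta) * be); [| apply Rmult_le_compat_r; lra].
    assert (Hb1 : be <= 1) by (unfold be; lra).
    unfold al, be in *. nra. }
  replace ((x + al * P / x) * (/ x - be * P))
    with (1 - (P / x ^ 2) * (x ^ 3 * be - al) - al * be * P ^ 2 / x) by (field; lra).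
  assert (0 < (P / x ^ 2) * (x ^ 3 * be - al)).
  { apply Rmult_lt_0_compat; [apply Rdiv_lt_0_compat; [lra | now apply pow_lt] | lra]. }
  assert (0 <= al * be * P ^ 2 / x).
  { apply Rdiv_le_0_compat; [| assumption].
    apply Rmult_le_pos; [apply Rmult_le_pos; unfold al; lra | apply pow2_ge_0]. }
  lra.
Qed.

(** * The exact mass formula for graphs *)

Section Mass.

Variables u du ddu : R -> R.
Hypothesis u_pos : forall z, 0 < u z.
Hypothesis u_derive : forall z, is_derive u z (du z).
Hypothesis du_derive : forall z, is_derive du z (ddu z).
Variable m : R.
Hypothesis du_sqr : forall z, du z ^ 2 = 1 - 2 * m / u z - u z ^ 2 / 3.
Hypothesis ddu_eq : forall z, ddu z = m / u z ^ 2 - u z / 3.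

Variables f b1 b2 a11 a12 a22 : R -> R -> R.
Hypothesis Hf : sphere_frame f b1 b2 a11 a12 a22.

Let q := gq b1 b2.
Let S := gS u f b1 b2.
Let D := gD u du f b1 b2 a11 a12 a22.
Let v (s t : R) : R := u (f s t).

Lemma C1D_u : C1D u. Proof. exact (C1D_derive _ _ u_derive). Qed.
Lemma C1D_du : C1D du. Proof. exact (C1D_derive _ _ du_derive). Qed.

Lemma frame_cont :
  C2D f /\ C2D b1 /\ C2D b2 /\ C2D q /\ C2D S /\ C2D D /\ C2D v.
Proof.
  destruct Hf as [_ _ _ _ _ _ Cf C1 C2 C11 C12 C22 _ _ _].
  assert (Cu := C1D_u). assert (Cdu := C1D_du).
  assert (Cq : C2D q) by (unfold q, gq; c2d).
  assert (Cv : C2D v) by (unfold v; c2d).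
  assert (CS : C2D S) by (change (C2D (fun s t => sqrt (v s t ^ 2 + q s t))); c2d).
  repeat (split; [assumption |]). split; [| assumption].
  change (C2D (fun s t => ((v s t ^ 2 + b2 s t ^ 2) * a11 s t + (v s t ^ 2 + b1 s t ^ 2) * a22 s t
     - 2 * b1 s t * b2 s t * a12 s t - v s t * du (f s t) * q s t) / S s t ^ 3)).
  c2d. intros s t. apply pow_nonzero, Rgt_not_eq, gS_pos; assumption.
Qed.

Lemma S_pos s t : 0 < S s t. Proof. now apply gS_pos. Qed.
Lemma v_pos s t : 0 < v s t. Proof. apply u_pos. Qed.
Lemma S_sqr s t : S s t ^ 2 = v s t ^ 2 + q s t. Proof. now apply gS_sqr. Qed.
Lemma q_pos s t : 0 <= q s t. Proof. apply gq_pos. Qed.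

Lemma v_s s t : is_derive (fun z => v z t) s (du (f s t) * b1 s t).
Proof.
  assert (H := sf_s _ _ _ _ _ _ Hf s t). rewrite Rmult_comm.
  apply (is_derive_comp u (fun z => f z t)); [apply u_derive | exact H].
Qed.

Lemma v_t s t : is_derive (fun z => v s z) t (sin s * (du (f s t) * b2 s t)).
Proof.
  assert (H := sf_t _ _ _ _ _ _ Hf s t).
  replace (sin s * (du (f s t) * b2 s t)) with ((sin s * b2 s t) * du (f s t)) by ring.
  apply (is_derive_comp u (fun z => f s z)); [apply u_derive | exact H].
Qed.

Lemma is_derive_sqrt_sum_sqr (x y1 y2 dx dy1 dy2 : R) (X Y1 Y2 : R -> R) (z : R) :
  X z = x -> Y1 z = y1 -> Y2 z = y2 ->
  is_derive X z dx -> is_derive Y1 z dy1 -> is_derive Y2 z dy2 -> 0 < x ^ 2 + (y1 ^ 2 + y2 ^ 2) ->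
  is_derive (fun z => sqrt (X z ^ 2 + (Y1 z ^ 2 + Y2 z ^ 2))) z
    ((x * dx + y1 * dy1 + y2 * dy2) / sqrt (x ^ 2 + (y1 ^ 2 + y2 ^ 2))).
Proof.
  intros <- <- <- HX H1 H2 Hp.
  assert (0 < sqrt (X z ^ 2 + (Y1 z ^ 2 + Y2 z ^ 2))) by now apply sqrt_lt_R0.
  auto_derive.
  - repeat match goal with |- _ /\ _ => split end; try (eexists; eassumption); try exact I.
    simpl in Hp |- *; assumption.
  - dsub. simpl in *. field. apply Rgt_not_eq; assumption.
Qed.

Lemma S_s s t :
  is_derive (fun z => S z t) s
    ((v s t * (du (f s t) * b1 s t) + b1 s t * a11 s t + b2 s t * a12 s t) / S s t).
Proof.
  apply (is_derive_sqrt_sum_sqr (v s t) (b1 s t) (b2 s t) _ _ _ (fun z => v z t) (fun z => b1 z t) (fun z => b2 z t));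
    try reflexivity.
  - apply v_s.
  - apply (sf_1s _ _ _ _ _ _ Hf).
  - apply (sf_2s _ _ _ _ _ _ Hf).
  - apply gS_arg_pos; assumption.
Qed.

Lemma S_t s t :
  is_derive (fun z => S s z) t
    (sin s * (v s t * (du (f s t) * b2 s t) + b1 s t * a12 s t + b2 s t * a22 s t) / S s t).
Proof.
  replace (sin s * _) with (v s t * (sin s * (du (f s t) * b2 s t))
     + b1 s t * (sin s * a12 s t + cos s * b2 s t) + b2 s t * (sin s * a22 s t - cos s * b1 s t))
    by ring.
  apply (is_derive_sqrt_sum_sqr (v s t) (b1 s t) (b2 s t) _ _ _ (v s) (b1 s) (b2 s)); try reflexivity.
  - apply v_t.
  - apply (sf_1t _ _ _ _ _ _ Hf).
  - apply (sf_2t _ _ _ _ _ _ Hf).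
  - apply gS_arg_pos; assumption.
Qed.

(** Divergence theorem for the field [p grad f / S], whose divergence is [p D] plus the inner
    product of [grad p] and [grad f] over S. [Y1] and [Y2] are its components times the density
    [sin s]; in [Y2] that factor cancels against the [1 / sin s] of the frame derivative. *)
Lemma avg_by_parts (p p1 p2 : R -> R -> R) :
  (forall s t, is_derive (fun z => p z t) s (p1 s t)) ->
  (forall s t, is_derive (fun z => p s z) t (sin s * p2 s t)) ->
  C2D p -> C2D p1 -> C2D p2 -> (forall s t, p s (t + 2 * PI) = p s t) ->
  avg (fun s t => p s t * D s t) = - avg (fun s t => (p1 s t * b1 s t + p2 s t * b2 s t) / S s t).
Proof.
  intros Hs Ht Cp C1 C2 Pp.
  destruct frame_cont as [Cf [Cb1 [Cb2 [Cq [CS [CD Cv]]]]]].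
  assert (HS : forall s t, S s t <> 0) by (intros; apply Rgt_not_eq, S_pos).
  assert (Cdu := C1D_du).
  destruct Hf as [_ _ _ _ _ _ _ _ _ C11 C12 C22 _ _ _].
  set (Y1 := fun s t => sin s * (p s t * (b1 s t / S s t))).
  set (Y2 := fun s t => p s t * (b2 s t / S s t)).
  set (dY1 := fun s t => cos s * (p s t * (b1 s t / S s t)) + sin s * (p1 s t * (b1 s t / S s t)
     + p s t * (a11 s t / S s t - b1 s t * (v s t * (du (f s t) * b1 s t) + b1 s t * a11 s t + b2 s t * a12 s t)
                   / S s t ^ 3))).
  set (dY2 := fun s t => sin s * p2 s t * (b2 s t / S s t)
     + p s t * ((sin s * a22 s t - cos s * b1 s t) / S s t
         - b2 s t * (sin s * (v s t * (du (f s t) * b2 s t) + b1 s t * a12 s t + b2 s t * a22 s t)) / S s t ^ 3)).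
  assert (H := sint_divergence Y1 Y2 dY1 dY2).
  assert (E : forall s t, dY1 s t + dY2 s t
     = sin s * (p s t * D s t + (p1 s t * b1 s t + p2 s t * b2 s t) / S s t)).
  { intros s t. unfold dY1, dY2, D, gD. fold S. fold (v s t). fold q.
    assert (Hq := S_sqr s t). specialize (HS s t).
    assert (Ev : v s t ^ 2 = S s t ^ 2 - b1 s t ^ 2 - b2 s t ^ 2) by (rewrite Hq; unfold q, gq; ring).
    unfold q, gq. field_simplify_eq; [| assumption]. rewrite ?Ev. ring. }
  assert (HS3 : forall s t, S s t ^ 3 <> 0) by (intros; now apply pow_nonzero).
  assert (H0 : avg (fun s t => p s t * D s t + (p1 s t * b1 s t + p2 s t * b2 s t) / S s t) = 0).
  { unfold avg. rewrite <- (sint_ext (fun s t => dY1 s t + dY2 s t)) by (intros; apply E).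
    rewrite H; [unfold Rdiv; ring | | | | | | | |].
    - intros s t. unfold Y1, dY1.
      assert (X1 := Hs s t). assert (X2 := sf_1s _ _ _ _ _ _ Hf s t). assert (X3 := S_s s t).
      auto_derive.
      + repeat match goal with |- _ /\ _ => split end; try (eexists; eassumption); auto.
      + dsub. field; apply HS.
    - intros s t. unfold Y2, dY2.
      assert (X1 := Ht s t). assert (X2 := sf_2t _ _ _ _ _ _ Hf s t). assert (X3 := S_t s t).
      auto_derive.
      + repeat match goal with |- _ /\ _ => split end; try (eexists; eassumption); auto.
      + dsub. field; apply HS.
    - unfold Y1; c2d.
    - unfold dY1; c2d.
    - unfold dY2; c2d.
    - intros t; unfold Y1; rewrite sin_0; ring.
    - intros t; unfold Y1; rewrite sin_PI; ring.
    - intros s t; unfold Y2, S, gS, gq.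
      now rewrite Pp, (sf_P _ _ _ _ _ _ Hf), (sf_P1 _ _ _ _ _ _ Hf), (sf_P2 _ _ _ _ _ _ Hf). }
  rewrite avg_plus in H0 by c2d. lra.
Qed.

Let F : surface := fun s t => mkvec (f s t) s t.

Lemma graph_area : area (dss_metric u) F = 4 * PI * avg (fun s t => v s t * S s t).
Proof.
  unfold area, surface_integral, avg.
  transitivity (sint (fun s t => sin s * (v s t * S s t))).
  - apply RInt_real_ext; intros s Hs; apply RInt_real_ext; intros t _.
    generalize PI_RGT_0; intros Hpi. rewrite Rmin_left, Rmax_right in Hs by lra.
    unfold F. rewrite (graph_area_element u u_pos f _ _ _ _ _ Hf) by now apply sin_gt_0.
    unfold v, S; ring.
  - field. generalize PI_RGT_0; lra.
Qed.

Lemma graph_willmore :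
  surface_integral (dss_metric u) F (fun s t => mean_curvature (dss_metric u) F s t ^ 2)
  = 4 * PI * avg (fun s t => S s t * D s t ^ 2 / v s t - 4 * (du (f s t) * D s t)
                             + 4 * (du (f s t) ^ 2 * v s t / S s t)).
Proof.
  unfold surface_integral, avg.
  transitivity (sint (fun s t => sin s * (S s t * D s t ^ 2 / v s t - 4 * (du (f s t) * D s t)
                             + 4 * (du (f s t) ^ 2 * v s t / S s t)))).
  - apply RInt_real_ext; intros s Hs; apply RInt_real_ext; intros t _.
    generalize PI_RGT_0; intros Hpi. rewrite Rmin_left, Rmax_right in Hs by lra.
    assert (0 < sin s) by now apply sin_gt_0.
    unfold F. rewrite (graph_area_element u u_pos f _ _ _ _ _ Hf) by assumption.
    rewrite (graph_mean_curvature u du u_pos u_derive f _ _ _ _ _ Hf) by assumption.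
    fold S. fold D. fold (v s t).
    generalize (S_pos s t) (v_pos s t); intros; field; split; lra.
  - field. generalize PI_RGT_0; lra.
Qed.

(* The first integral of the profile equation turns both the zeroth order terms and
   the term obtained by parts from du(f) * D into multiples of m. *)
Lemma graph_hawking_mass :
  hawking_mass (dss_metric u) F 2
  = sqrt (avg (fun s t => v s t * S s t)) / 2 *
    (1 - avg (fun s t => S s t * D s t ^ 2 / v s t + 4 * (v s t / S s t)) / 4
     + 2 * m * avg (fun s t => (2 * v s t ^ 2 - q s t) / (2 * v s t ^ 2 * S s t))).
Proof.
  destruct frame_cont as [Cf [Cb1 [Cb2 [Cq [CS [CD Cv]]]]]].
  assert (HS : forall s t, S s t <> 0) by (intros; apply Rgt_not_eq, S_pos).
  assert (Hv : forall s t, v s t <> 0) by (intros; apply Rgt_not_eq, v_pos).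
  assert (Cdu := C1D_du).
  assert (Cddu : C2D (fun s t => m / v s t ^ 2 - v s t / 3))
    by (c2d; intros; now (apply pow_nonzero || lra)).
  unfold hawking_mass. rewrite graph_area, graph_willmore.
  generalize PI_RGT_0; intros Hpi.
  replace (sqrt (avg (fun s t => v s t * S s t)) / 2)
    with (sqrt (4 * PI * avg (fun s t => v s t * S s t) / (16 * PI))).
  2:{ replace (4 * PI * avg (fun s t => v s t * S s t) / (16 * PI))
        with (avg (fun s t => v s t * S s t) / 2 ^ 2) by (field; lra).
      rewrite sqrt_div_alt, sqrt_pow2 by lra; reflexivity. }
  f_equal.
  assert (IBP := avg_by_parts (fun s t => du (f s t))
     (fun s t => (m / v s t ^ 2 - v s t / 3) * b1 s t)
     (fun s t => (m / v s t ^ 2 - v s t / 3) * b2 s t)).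
  assert (Hv2S : forall s t, 2 * v s t ^ 2 * S s t <> 0).
  { intros s t. repeat apply Rmult_integral_contrapositive_currified; auto; lra. }
  set (W := avg (fun s t => S s t * D s t ^ 2 / v s t - 4 * (du (f s t) * D s t)
                             + 4 * (du (f s t) ^ 2 * v s t / S s t))).
  set (A := avg (fun s t => v s t * S s t)).
  replace (/ (16 * PI) * (4 * PI * W)) with (W / 4) by (field; lra).
  replace (2 / (24 * PI) * (4 * PI * A)) with (A / 3) by (field; lra).
  assert (EW : W = avg (fun s t => S s t * D s t ^ 2 / v s t)
      + 4 * avg (fun s t => ((m / v s t ^ 2 - v s t / 3) * b1 s t * b1 s t
             + (m / v s t ^ 2 - v s t / 3) * b2 s t * b2 s t) / S s t)
      + 4 * avg (fun s t => du (f s t) ^ 2 * v s t / S s t)).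
  { unfold W. rewrite avg_plus, avg_minus, !avg_scal by c2d.
    rewrite IBP; [ring | | | | | |]; try (c2d; fail).
    - intros s t.
      assert (X := sf_s _ _ _ _ _ _ Hf s t). unfold v. rewrite <- ddu_eq, Rmult_comm.
      apply (is_derive_comp du (fun z => f z t)); [apply du_derive | exact X].
    - intros s t.
      assert (X := sf_t _ _ _ _ _ _ Hf s t). unfold v. rewrite <- ddu_eq.
      replace (sin s * (ddu (f s t) * b2 s t)) with ((sin s * b2 s t) * ddu (f s t)) by ring.
      apply (is_derive_comp du (fun z => f s z)); [apply du_derive | exact X].
    - intros s t; now rewrite (sf_P _ _ _ _ _ _ Hf). }
  (* Among the terms without [m], [- 4 v q / (3 S)] from the integration by parts, [- 4 v^3 / (3 S)]
     from [du ^ 2] and the area term [4 v S / 3] cancel, since [S ^ 2 = v ^ 2 + q]. *)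
  assert (E1 : avg (fun s t => 4 * (((m / v s t ^ 2 - v s t / 3) * b1 s t * b1 s t
             + (m / v s t ^ 2 - v s t / 3) * b2 s t * b2 s t) / S s t)
           + 4 * (du (f s t) ^ 2 * v s t / S s t) + 4 / 3 * (v s t * S s t))
      = avg (fun s t => 4 * (v s t / S s t)
          - 8 * m * ((2 * v s t ^ 2 - q s t) / (2 * v s t ^ 2 * S s t)))).
  { apply avg_ext; intros s t. rewrite du_sqr. fold (v s t).
    replace (v s t * S s t) with (v s t * S s t ^ 2 / S s t) by (field; auto).
    rewrite S_sqr. unfold q, gq. field. split; auto. }
  rewrite !avg_plus, avg_minus, !avg_scal in E1 by c2d. fold A in E1.
  rewrite avg_plus, avg_scal by c2d.
  rewrite EW; lra.
Qed.

(** * Estimates for graphs close to a slice *)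

Variables u0 eta kappa : R.
Hypothesis u0_pos : 0 < u0.
Hypothesis eta_bd : 0 < eta <= / 20.
Hypothesis v_bd : forall s t, u0 * (1 - eta) <= v s t <= u0 * (1 + eta).
Hypothesis q_bd : forall s t, q s t <= eta ^ 2 * u0 ^ 2.

Let P : R := avg q / u0 ^ 2.

Lemma inv_v_sqr_bd s t : / v s t ^ 2 <= (1 + 3 * eta) / u0 ^ 2.
Proof.
  destruct (v_bd s t) as [Hl _]. assert (Hv := v_pos s t).
  assert (H2 : 0 < v s t ^ 2) by now apply pow_lt.
  assert (H3 : 0 < u0 ^ 2) by now apply pow_lt.
  apply Rmult_le_reg_r with (v s t ^ 2); [assumption |]. rewrite Rinv_l by lra.
  apply Rmult_le_reg_r with (u0 ^ 2); [assumption |].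
  replace ((1 + 3 * eta) / u0 ^ 2 * v s t ^ 2 * u0 ^ 2) with ((1 + 3 * eta) * v s t ^ 2)
    by (field; lra).
  assert (H4 : (u0 * (1 - eta)) ^ 2 <= v s t ^ 2) by (apply pow_incr; nra).
  apply Rle_trans with ((1 + 3 * eta) * (u0 * (1 - eta)) ^ 2); [| apply Rmult_le_compat_l; lra].
  replace ((1 + 3 * eta) * (u0 * (1 - eta)) ^ 2) with ((1 + 3 * eta) * (1 - eta) ^ 2 * u0 ^ 2) by ring.
  apply Rmult_le_compat_r; [lra |]. nra.
Qed.

Lemma inv_S_bd s t : (1 - 2 * eta) / u0 <= / S s t.
Proof.
  assert (HS := S_pos s t).
  apply Rmult_le_reg_r with (S s t); [assumption |]. rewrite Rinv_l by lra.
  assert (H : S s t <= u0 * (1 + 2 * eta)).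
  { apply Rsqr_incr_0_var; [| nra]. rewrite !Rsqr_pow2, S_sqr.
    destruct (v_bd s t) as [_ Hu]. assert (Hv := v_pos s t). assert (Hq := q_bd s t).
    assert (v s t ^ 2 <= (u0 * (1 + eta)) ^ 2) by (apply pow_incr; lra).
    assert (0 < u0 ^ 2) by now apply pow_lt. nra. }
  replace 1 with (/ u0 * u0) at 2 by (field; lra).
  replace ((1 - 2 * eta) / u0 * S s t) with (/ u0 * ((1 - 2 * eta) * S s t)) by (field; lra).
  apply Rmult_le_compat_l; [left; now apply Rinv_0_lt_compat |].
  apply Rle_trans with ((1 - 2 * eta) * (u0 * (1 + 2 * eta))); [apply Rmult_le_compat_l; lra | nra].
Qed.

(** Both terms are replaced by lower bounds free of second derivatives other than through [D] to the
    first power, which integrates by parts against [f - c]. The contributions of order [P] then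
    cancel and only multiples of [eta * P] remain. *)
Lemma willmore_lower_bound :
  4 - 14 * eta * P <= avg (fun s t => S s t * D s t ^ 2 / v s t + 4 * (v s t / S s t)).
Proof.
  destruct frame_cont as [Cf [Cb1 [Cb2 [Cq [CS [CD Cv]]]]]].
  assert (HS : forall s t, S s t <> 0) by (intros; apply Rgt_not_eq, S_pos).
  assert (Hv : forall s t, v s t <> 0) by (intros; apply Rgt_not_eq, v_pos).
  assert (Hv2 : forall s t, v s t ^ 2 <> 0) by (intros; now apply pow_nonzero).
  assert (H0 : u0 ^ 2 <> 0) by (apply pow_nonzero; lra).
  set (c := avg f).
  apply Rle_trans with (avg (fun s t => (- 4 / u0) * ((f s t - c) * D s t)
     - 4 / u0 ^ 2 * (f s t - c) ^ 2 + 4 - 2 * (q s t / v s t ^ 2))).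
  - assert (IBP := avg_by_parts (fun s t => f s t - c) b1 b2).
    assert (Poi := avg_poincare f b1 b2).
    destruct Hf as [Hs Ht _ _ _ _ _ _ _ _ _ _ HP HP1 HP2].
    specialize (Poi Hs Ht Cf Cb1 Cb2 HP HP2). fold c in Poi.
    rewrite avg_minus, avg_plus, avg_minus, !avg_scal, avg_const by c2d.
    rewrite IBP; try (c2d; fail).
    2:{ intros s t; assert (X := Hs s t). auto_derive; [eexists; apply X | dsub; ring]. }
    2:{ intros s t; assert (X := Ht s t). auto_derive; [eexists; apply X | dsub; ring]. }
    2:{ intros s t; now rewrite HP. }
    (* Here [2 - 14 eta = 4 (1 - 2 eta) - 2 (1 + 3 eta)], from the bounds on [/ S] and [/ v ^ 2];
       the main part 2 is what the Poincare inequality consumes below. *)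
    assert (B : (2 - 14 * eta) / u0 ^ 2 * avg q
             <= avg (fun s t => 4 / u0 * ((b1 s t * b1 s t + b2 s t * b2 s t) / S s t)
                        - 2 * (q s t / v s t ^ 2))).
    { rewrite <- avg_scal by c2d. apply avg_le; [c2d | c2d |]. intros s t.
      replace (b1 s t * b1 s t + b2 s t * b2 s t) with (q s t) by (unfold q, gq; ring).
      assert (I1 := inv_v_sqr_bd s t). assert (I2 := inv_S_bd s t). assert (Hq := q_pos s t).
      assert (J1 : q s t / v s t ^ 2 <= q s t * ((1 + 3 * eta) / u0 ^ 2))
        by (apply Rmult_le_compat_l; assumption).
      assert (J2 : q s t * ((1 - 2 * eta) / u0) <= q s t / S s t)
        by (apply Rmult_le_compat_l; assumption).
      assert (J3 : 4 / u0 * (q s t * ((1 - 2 * eta) / u0)) <= 4 / u0 * (q s t / S s t))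
        by (apply Rmult_le_compat_l; [left; apply Rdiv_lt_0_compat; lra | assumption]).
      replace ((2 - 14 * eta) / u0 ^ 2 * q s t)
        with (4 / u0 * (q s t * ((1 - 2 * eta) / u0)) - 2 * (q s t * ((1 + 3 * eta) / u0 ^ 2)))
        by (field; lra).
      lra. }
    rewrite avg_minus, !avg_scal in B by c2d.
    change (avg (fun s t => b1 s t ^ 2 + b2 s t ^ 2)) with (avg q) in Poi.
    assert (B2 : 4 / u0 ^ 2 * avg (fun s t => (f s t - c) ^ 2) <= 2 / u0 ^ 2 * avg q).
    { replace (4 / u0 ^ 2 * avg (fun s t => (f s t - c) ^ 2))
        with (2 / u0 ^ 2 * (2 * avg (fun s t => (f s t - c) ^ 2))) by (field; lra).
      apply Rmult_le_compat_l; [left; apply Rdiv_lt_0_compat; [lra | now apply pow_lt] | assumption]. }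
    unfold P.
    replace (14 * eta * (avg q / u0 ^ 2)) with (2 / u0 ^ 2 * avg q - (2 - 14 * eta) / u0 ^ 2 * avg q)
      by (field; lra).
    replace (- 4 / u0) with (- (4 / u0)) by (field; lra).
    lra.
  - apply avg_le; [c2d | c2d |]. intros s t.
    set (p := - 2 * (f s t - c) / u0).
    replace (- 4 / u0 * ((f s t - c) * D s t) - 4 / u0 ^ 2 * (f s t - c) ^ 2)
      with (2 * p * D s t - p ^ 2) by (unfold p; field; lra).
    assert (HSp := S_pos s t). assert (Hvp := v_pos s t). assert (Hq := q_pos s t).
    assert (HSq := S_sqr s t).
    assert (Hvp2 : 0 < v s t ^ 2) by now apply pow_lt.
    assert (Hle : v s t <= S s t) by (apply Rsqr_incr_0_var; [rewrite !Rsqr_pow2 |]; lra).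
    assert (A1 : D s t ^ 2 <= S s t * D s t ^ 2 / v s t).
    { apply Rmult_le_reg_r with (v s t); [assumption |].
      replace (S s t * D s t ^ 2 / v s t * v s t) with (S s t * D s t ^ 2) by (field; auto).
      rewrite Rmult_comm. apply Rmult_le_compat_r; [apply pow2_ge_0 | assumption]. }
    assert (A2 : 0 <= (D s t - p) ^ 2) by apply pow2_ge_0.
    (* With [y = S / v] the difference of the two sides is [2 (y - 1)^2 (y + 2) / y]. *)
    assert (A3 : 4 - 2 * (q s t / v s t ^ 2) <= 4 * (v s t / S s t)).
    { replace (q s t) with (S s t ^ 2 - v s t ^ 2) by lra.
      set (y := S s t / v s t).
      assert (Hy : 1 <= y).
      { unfold y; apply Rmult_le_reg_r with (v s t); [assumption |].
        replace (S s t / v s t * v s t) with (S s t) by (field; auto). lra. }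
      replace ((S s t ^ 2 - v s t ^ 2) / v s t ^ 2) with (y ^ 2 - 1) by (unfold y; field; auto).
      replace (v s t / S s t) with (/ y) by (unfold y; field; auto).
      apply Rmult_le_reg_r with y; [lra |].
      replace (4 * / y * y) with 4 by (field; lra).
      assert (0 <= (y - 1) ^ 2 * (y + 2)) by (apply Rmult_le_pos; [apply pow2_ge_0 | lra]).
      nra. }
    lra.
Qed.

(** [c] expresses the Willmore error in the scale of the mass term: a quarter of [14 eta P] equals
    [(2 m / u0) * c eta P]. *)
Variable c : R.
Hypothesis c_eq : c = 7 * u0 / (4 * m).
Hypothesis m_pos : 0 < m.
Hypothesis kappa_bd : 0 <= kappa < 1.
Hypothesis du_bd : forall s t, du (f s t) ^ 2 <= kappa.
Hypothesis eta_small : (9 + c) * eta <= (1 - kappa) / 2.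

Let vb : R := avg v.
Let V : R := avg (fun s t => (v s t - vb) ^ 2).

Lemma vb_bd : u0 * (1 - eta) <= vb <= u0 * (1 + eta).
Proof.
  destruct frame_cont as [Cf [Cb1 [Cb2 [Cq [CS [CD Cv]]]]]].
  split; [rewrite <- (avg_const (u0 * (1 - eta))) | rewrite <- (avg_const (u0 * (1 + eta)))];
    apply avg_le; try c2d; apply v_bd.
Qed.

Lemma variance_bd : 0 <= V /\ 2 * V <= kappa * (u0 ^ 2 * P).
Proof.
  destruct frame_cont as [Cf [Cb1 [Cb2 [Cq [CS [CD Cv]]]]]].
  assert (Cdu := C1D_du).
  split; [apply avg_ge_0; [c2d | intros; apply pow2_ge_0] |].
  apply Rle_trans with (avg (fun s t => (du (f s t) * b1 s t) ^ 2 + (du (f s t) * b2 s t) ^ 2)).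
  - apply avg_poincare; try c2d; try apply v_s; try apply v_t.
    + intros; unfold v; now rewrite (sf_P _ _ _ _ _ _ Hf).
    + intros; now rewrite (sf_P _ _ _ _ _ _ Hf), (sf_P2 _ _ _ _ _ _ Hf).
  - replace (kappa * (u0 ^ 2 * P)) with (avg (fun s t => kappa * q s t))
      by (rewrite avg_scal by c2d; unfold P; field; lra).
    apply avg_le; [c2d | c2d |]. intros s t.
    replace ((du (f s t) * b1 s t) ^ 2 + (du (f s t) * b2 s t) ^ 2) with (du (f s t) ^ 2 * q s t)
      by (unfold q, gq; ring).
    apply Rmult_le_compat_r; [apply q_pos | apply du_bd].
Qed.

(** [v S <= (v^2 + S^2) / 2 = v^2 + q / 2], and the average of [v^2] is the squared mean plus the
    variance. *)
Lemma area_bd : avg (fun s t => v s t * S s t) <= vb ^ 2 + V + u0 ^ 2 * P / 2.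
Proof.
  destruct frame_cont as [Cf [Cb1 [Cb2 [Cq [CS [CD Cv]]]]]].
  replace (vb ^ 2 + V + u0 ^ 2 * P / 2) with (avg (fun s t => v s t ^ 2 + / 2 * q s t)).
  - apply avg_le; [c2d | c2d |]. intros s t.
    generalize (S_sqr s t) (pow2_ge_0 (v s t - S s t)); nra.
  - assert (E : V = avg (fun s t => v s t ^ 2) - 2 * vb * vb + vb ^ 2).
    { unfold V. rewrite (avg_ext _ (fun s t => v s t ^ 2 - (2 * vb) * v s t + vb ^ 2)) by (intros; ring).
      rewrite avg_plus, avg_minus, avg_scal, avg_const by c2d. reflexivity. }
    rewrite avg_plus, avg_scal, E by c2d. unfold P; field; lra.
Qed.

(** With [y = S / v] and [p = q / v^2 = y^2 - 1] the left side is [(2 - p) / (2 y)] over [v]. The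
    numerator and [1 / y] each contribute [- p / 2] to first order, so that it is close to
    [(1 - p) / v = 1 / v - q / v^3]. *)
Lemma ode_term_pointwise s t :
  (2 * v s t ^ 2 - q s t) / (2 * v s t ^ 2 * S s t)
  <= / v s t - (1 - 4 * eta) / u0 ^ 3 * q s t.
Proof.
  assert (HS := S_pos s t). assert (Hv := v_pos s t). assert (Hq := q_pos s t).
  assert (Hqb := q_bd s t). destruct (v_bd s t) as [Hl Hu]. assert (HSq := S_sqr s t).
  assert (H2 : 0 < u0 ^ 2) by now apply pow_lt. assert (H3 : 0 < u0 ^ 3) by now apply pow_lt.
  assert (Hle : v s t <= S s t) by (apply Rsqr_incr_0_var; [rewrite !Rsqr_pow2 |]; lra).
  set (y := S s t / v s t). set (p := q s t / v s t ^ 2).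
  assert (Hv2 : 0 < v s t ^ 2) by now apply pow_lt.
  assert (Hv3 : 0 < v s t ^ 3) by now apply pow_lt.
  assert (Ey : y ^ 2 = 1 + p).
  { unfold y, p. replace ((S s t / v s t) ^ 2) with (S s t ^ 2 / v s t ^ 2) by (field; lra).
    rewrite HSq; field; lra. }
  assert (Hy : 1 <= y).
  { unfold y; apply Rmult_le_reg_r with (v s t); [assumption |].
    replace (S s t / v s t * v s t) with (S s t) by (field; lra). lra. }
  assert (Hp : 0 <= p) by (apply Rdiv_le_0_compat; assumption).
  assert (Hpb : p <= eta / 10).
  { apply Rle_trans with (eta ^ 2 * u0 ^ 2 * ((1 + 3 * eta) / u0 ^ 2)).
    - unfold p, Rdiv at 1. apply Rmult_le_compat; try assumption.
      + left; now apply Rinv_0_lt_compat.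
      + apply inv_v_sqr_bd.
    - replace (eta ^ 2 * u0 ^ 2 * ((1 + 3 * eta) / u0 ^ 2)) with (eta * (eta * (1 + 3 * eta)))
        by (field; lra).
      replace (eta / 10) with (eta * / 10) by field.
      apply Rmult_le_compat_l; nra. }
  assert (E1 : (2 * v s t ^ 2 - q s t) / (2 * v s t ^ 2 * S s t) = / v s t * ((2 - p) / (2 * y)))
    by (unfold p, y; field; lra).
  assert (E2 : (2 - p) / (2 * y) <= 1 - (1 - eta / 5) * p).
  { apply Rmult_le_reg_r with (2 * y); [lra |].
    replace ((2 - p) / (2 * y) * (2 * y)) with (2 - p) by (field; lra).
    replace p with (y ^ 2 - 1) by lra.
    assert (Hyp : y <= 1 + p / 2) by nra.
    (* This product is [2 y] times the difference of the two sides. Its second factor is [4 eta / 5]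
       at [y = 1], and stays nonnegative because [p <= eta / 10]. *)
    assert (0 <= (y - 1) * (y + 3 - 2 * (1 - eta / 5) * (y ^ 2 + y))).
    { apply Rmult_le_pos; [lra |]. rewrite Ey. nra. }
    nra. }
  rewrite E1.
  apply Rle_trans with (/ v s t * (1 - (1 - eta / 5) * p)).
  { apply Rmult_le_compat_l; [left; now apply Rinv_0_lt_compat | assumption]. }
  assert (E3 : (1 - 3 * eta) / u0 ^ 3 <= / v s t ^ 3).
  { apply Rmult_le_reg_r with (v s t ^ 3); [assumption |]. rewrite Rinv_l by lra.
    apply Rle_trans with ((1 - 3 * eta) / u0 ^ 3 * (u0 * (1 + eta)) ^ 3).
    - apply Rmult_le_compat_l; [apply Rdiv_le_0_compat; lra | apply pow_incr; lra].
    - replace ((1 - 3 * eta) / u0 ^ 3 * (u0 * (1 + eta)) ^ 3) with ((1 - 3 * eta) * (1 + eta) ^ 3)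
        by (field; lra).
      assert (0 <= eta ^ 2) by apply pow2_ge_0. assert (0 <= eta ^ 3) by (apply pow_le; lra).
      assert (0 <= eta ^ 4) by (apply pow_le; lra).
      replace ((1 - 3 * eta) * (1 + eta) ^ 3) with (1 - 6 * eta ^ 2 - 8 * eta ^ 3 - 3 * eta ^ 4)
        by ring. lra. }
  replace (/ v s t * (1 - (1 - eta / 5) * p))
    with (/ v s t - (1 - eta / 5) * (q s t * / v s t ^ 3)) by (unfold p; field; lra).
  assert (E4 : q s t * ((1 - 3 * eta) / u0 ^ 3) <= q s t * / v s t ^ 3)
    by (apply Rmult_le_compat_l; assumption).
  assert (E5 : (1 - eta / 5) * (q s t * ((1 - 3 * eta) / u0 ^ 3))
               <= (1 - eta / 5) * (q s t * / v s t ^ 3)) by (apply Rmult_le_compat_l; lra).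
  assert (E6 : (1 - 4 * eta) / u0 ^ 3 * q s t <= (1 - eta / 5) * (q s t * ((1 - 3 * eta) / u0 ^ 3))).
  { assert (0 <= q s t / u0 ^ 3) by (apply Rdiv_le_0_compat; assumption).
    replace ((1 - 4 * eta) / u0 ^ 3 * q s t) with ((1 - 4 * eta) * (q s t / u0 ^ 3)) by (field; lra).
    replace ((1 - eta / 5) * (q s t * ((1 - 3 * eta) / u0 ^ 3)))
      with ((1 - eta / 5) * (1 - 3 * eta) * (q s t / u0 ^ 3)) by (field; lra).
    apply Rmult_le_compat_r; [assumption | nra]. }
  lra.
Qed.

(* Second order expansion of 1 / v at its mean; the first order term averages to 0. *)
Lemma inv_v_pointwise s t :
  / v s t <= / vb - (v s t - vb) / vb ^ 2 + (1 + 4 * eta) / u0 ^ 3 * (v s t - vb) ^ 2.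
Proof.
  assert (Hv := v_pos s t). destruct (v_bd s t) as [Hl Hu]. destruct vb_bd as [Hbl Hbu].
  assert (Hw : 0 < u0 * (1 - eta)) by (apply Rmult_lt_0_compat; lra).
  assert (Hb : 0 < vb) by lra. assert (H3 : 0 < u0 ^ 3) by now apply pow_lt.
  assert (Hb2 : 0 < vb ^ 2) by now apply pow_lt.
  replace (/ v s t) with (/ vb - (v s t - vb) / vb ^ 2 + / (v s t * vb ^ 2) * (v s t - vb) ^ 2)
    by (field; lra).
  apply Rplus_le_compat_l, Rmult_le_compat_r; [apply pow2_ge_0 |].
  assert (Hprod : 0 < v s t * vb ^ 2) by now apply Rmult_lt_0_compat.
  apply Rmult_le_reg_r with (v s t * vb ^ 2); [assumption |]. rewrite Rinv_l by lra.
  apply Rle_trans with ((1 + 4 * eta) / u0 ^ 3 * (u0 * (1 - eta)) ^ 3).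
  - replace ((1 + 4 * eta) / u0 ^ 3 * (u0 * (1 - eta)) ^ 3) with ((1 + 4 * eta) * (1 - eta) ^ 3)
      by (field; lra).
    assert (0 <= eta * (1 - 9 * eta)) by (apply Rmult_le_pos; lra).
    assert (0 <= eta ^ 3 * (11 - 4 * eta)) by (apply Rmult_le_pos; [apply pow_le |]; lra).
    nra.
  - apply Rmult_le_compat_l; [apply Rdiv_le_0_compat; lra |].
    replace ((u0 * (1 - eta)) ^ 3) with (u0 * (1 - eta) * (u0 * (1 - eta)) ^ 2) by ring.
    apply Rmult_le_compat; try lra; [apply pow2_ge_0 | apply pow_incr; lra].
Qed.

Lemma ode_term_bd :
  avg (fun s t => (2 * v s t ^ 2 - q s t) / (2 * v s t ^ 2 * S s t))
  <= / vb + (1 + 4 * eta) / u0 ^ 3 * V - (1 - 4 * eta) / u0 * P.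
Proof.
  destruct frame_cont as [Cf [Cb1 [Cb2 [Cq [CS [CD Cv]]]]]].
  destruct vb_bd as [Hbl Hbu].
  assert (Hw : 0 < u0 * (1 - eta)) by (apply Rmult_lt_0_compat; lra).
  assert (HvS : forall s t, 2 * v s t ^ 2 * S s t <> 0).
  { intros s t; apply Rgt_not_eq. generalize (S_pos s t) (pow_lt _ 2 (v_pos s t)); intros.
    apply Rmult_lt_0_compat; [apply Rmult_lt_0_compat |]; lra. }
  assert (Hb2 : vb ^ 2 <> 0) by (apply pow_nonzero; lra).
  apply Rle_trans with (avg (fun s t => (/ vb - / vb ^ 2 * (v s t - vb)
     + (1 + 4 * eta) / u0 ^ 3 * (v s t - vb) ^ 2) - (1 - 4 * eta) / u0 ^ 3 * q s t)).
  - apply avg_le; [c2d | c2d |]. intros s t.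
    generalize (ode_term_pointwise s t) (inv_v_pointwise s t).
    replace ((v s t - vb) / vb ^ 2) with (/ vb ^ 2 * (v s t - vb)) by (field; lra). lra.
  - rewrite avg_minus, avg_plus, avg_minus, !avg_scal, avg_minus, !avg_const by c2d.
    fold vb. fold V. unfold P. right. field; lra.
Qed.

Lemma graph_mass_lt : 0 < avg q -> hawking_mass (dss_metric u) F 2 < m.
Proof.
  intros Hq. rewrite graph_hawking_mass.
  assert (HP : 0 < P) by (apply Rdiv_lt_0_compat; [assumption | now apply pow_lt]).
  assert (H2 : 0 < u0 ^ 2) by now apply pow_lt.
  destruct vb_bd as [Hbl Hbu]. destruct variance_bd as [HV HVP].
  assert (Hw : 0 < u0 * (1 - eta)) by (apply Rmult_lt_0_compat; lra).
  assert (HA0 : 0 <= avg (fun s t => v s t * S s t)).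
  { destruct frame_cont as [Cf [Cb1 [Cb2 [Cq [CS [CD Cv]]]]]].
    apply avg_ge_0; [c2d | intros s t]. generalize (S_pos s t) (v_pos s t); nra. }
  assert (HA := area_bd). set (A := avg (fun s t => v s t * S s t)) in *.
  set (x := vb / u0). set (Vn := V / u0 ^ 2).
  (* An upper bound for the bracket of the mass formula divided by [2 m / u0], its value on the
     slice; [sqrt A] is likewise measured in units of [u0], so the goal becomes a product below
     1. *)
  set (Y := / x + (1 + 4 * eta) * Vn - (1 - 4 * eta) * P + c * eta * P).
  assert (N : sqrt (A / u0 ^ 2) * Y < 1).
  { apply normalized_mass_lt_1 with kappa; try assumption.
    - unfold x; split; apply Rmult_le_reg_r with u0; try assumption;
        (replace (vb / u0 * u0) with vb by (field; lra)); lra.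
    - now apply Rdiv_le_0_compat.
    - unfold Vn. apply Rmult_le_reg_r with (u0 ^ 2); [assumption |].
      replace (2 * (V / u0 ^ 2) * u0 ^ 2) with (2 * V) by (field; lra). lra.
    - rewrite c_eq. apply Rdiv_le_0_compat; lra.
    - split; [now apply Rdiv_le_0_compat |].
      apply Rmult_le_reg_r with (u0 ^ 2); [assumption |].
      replace (A / u0 ^ 2 * u0 ^ 2) with A by (field; lra).
      replace ((x ^ 2 + Vn + P / 2) * u0 ^ 2) with (vb ^ 2 + V + u0 ^ 2 * P / 2)
        by (unfold x, Vn; field; lra). assumption. }
  assert (Hsq : sqrt A = u0 * sqrt (A / u0 ^ 2)).
  { rewrite sqrt_div_alt, sqrt_pow2 by lra. field; lra. }
  rewrite Hsq. assert (HW := willmore_lower_bound). assert (HQ := ode_term_bd).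
  set (W := avg (fun s t => S s t * D s t ^ 2 / v s t + 4 * (v s t / S s t))) in *.
  set (Q := avg (fun s t => (2 * v s t ^ 2 - q s t) / (2 * v s t ^ 2 * S s t))) in *.
  assert (HQm : m * Q <= m * (/ vb + (1 + 4 * eta) / u0 ^ 3 * V - (1 - 4 * eta) / u0 * P))
    by (apply Rmult_le_compat_l; lra).
  assert (HY : 1 - W / 4 + 2 * m * Q <= 2 * m / u0 * Y).
  { replace (2 * m / u0 * Y) with (7 / 2 * eta * P
      + 2 * (m * (/ vb + (1 + 4 * eta) / u0 ^ 3 * V - (1 - 4 * eta) / u0 * P)))
      by (unfold Y, x, Vn; rewrite c_eq; field; lra). lra. }
  apply Rle_lt_trans with (u0 * sqrt (A / u0 ^ 2) / 2 * (2 * m / u0 * Y)).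
  - apply Rmult_le_compat_l; [| assumption].
    generalize (sqrt_pos (A / u0 ^ 2)); intros; apply Rdiv_le_0_compat; [apply Rmult_le_pos |]; lra.
  - replace (u0 * sqrt (A / u0 ^ 2) / 2 * (2 * m / u0 * Y)) with (m * (sqrt (A / u0 ^ 2) * Y))
      by (field; lra).
    rewrite <- (Rmult_1_r m) at 2. apply Rmult_lt_compat_l; assumption.
Qed.

End Mass.

(** * Slices *)

Lemma sphere_frame_const (r : R) :
  sphere_frame (fun _ _ => r) (fun _ _ => 0) (fun _ _ => 0) (fun _ _ => 0) (fun _ _ => 0) (fun _ _ => 0).
Proof.
  split; intros; try apply C2D_const; try reflexivity;
    rewrite ?Rmult_0_r, ?Rplus_0_r, ?Rminus_0_r;
    apply (is_derive_const (K := R_AbsRing) (V := R_NormedModule)).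
Qed.

(** For constant [f] one has [q = D = 0] and [S = v = u r], so the mass formula reads
    [u r / 2 * (1 - 1 + 2 * m / u r)]. *)
Lemma slice_mass (u du ddu : R -> R) (m r : R) :
  (forall z, 0 < u z) -> (forall z, is_derive u z (du z)) -> (forall z, is_derive du z (ddu z)) ->
  (forall z, du z ^ 2 = 1 - 2 * m / u z - u z ^ 2 / 3) ->
  (forall z, ddu z = m / u z ^ 2 - u z / 3) ->
  hawking_mass (dss_metric u) (fun s t => mkvec r s t) 2 = m.
Proof.
  intros Hu Hdu Hddu Hsq Hdd.
  rewrite (graph_hawking_mass u du ddu Hu Hdu Hddu m Hsq Hdd _ _ _ _ _ _ (sphere_frame_const r)).
  assert (Hr := Hu r).
  assert (ES : forall s t, gS u (fun _ _ => r) (fun _ _ => 0) (fun _ _ => 0) s t = u r).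
  { intros s t. unfold gS, gq.
    replace (u r ^ 2 + (0 ^ 2 + 0 ^ 2)) with (u r ^ 2) by ring. apply sqrt_pow2; lra. }
  rewrite (avg_ext _ (fun _ _ => u r ^ 2)), avg_const by (intros; rewrite ES; ring).
  rewrite (avg_ext _ (fun _ _ => 4)), avg_const
    by (intros; rewrite ES; unfold gD; rewrite ES; unfold gq; field; lra).
  rewrite (avg_ext _ (fun _ _ => / u r)), avg_const by (intros; rewrite ES; unfold gq; field; lra).
  rewrite sqrt_pow2 by lra. field; lra.
Qed.

(** * Conclusion *)

(** The derivative of the left side is [u' (1 - u'^2 - 2 u u'' - u^2)], which the profile equation
    makes 0; the right side is its value at 0. *)
Lemma profile_first_integral (a : R) (u : R -> R) :
  deSitter_profile a u ->
  forall z, u z * (1 - Derive u z ^ 2) - u z ^ 3 / 3 = a - a ^ 3 / 3.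
Proof.
  intros [Hpos H1 H2 Hode Hi Hi' _] z.
  set (E := fun z => u z * (1 - Derive u z ^ 2) - u z ^ 3 / 3).
  assert (E0 : E 0 = a - a ^ 3 / 3) by (unfold E; rewrite Hi, Hi'; field).
  assert (HE : forall z, is_derive E z 0).
  { intros y. generalize (Hpos y) (Derive_correct _ _ (H1 y)) (Derive_correct _ _ (H2 y)).
    set (du := Derive u) in *. intros Hp X1 X2. unfold E.
    auto_derive; [repeat split; eexists; eassumption |].
    dsub. change (Derive u) with du. rewrite Hode. field; lra. }
  change (E z = a - a ^ 3 / 3). rewrite <- E0.
  destruct (Rtotal_order z 0) as [Hz | [-> | Hz]]; [| reflexivity |].
  - apply eq_is_derive; [intros; apply HE | assumption].
  - symmetry; apply eq_is_derive; [intros; apply HE | assumption].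
Qed.

Theorem theorem1p2 (a : R) (Ha : 0 < a < 1)
    (u : R -> R) (Hu : deSitter_profile a u) (r : R) :
  exists eps : R, 0 < eps /\
    forall (phi : vec -> R) (Sigma : R * vec -> Prop),
      C2_sphere phi ->
      Rbar_lt (C2_norm (u r) phi) eps ->
      (forall p, Sigma p <-> normal_graph r phi p) ->
      dss_hawking_mass_graph u r phi < dss_hawking_mass_slice u r
      \/ exists s : R, forall p, Sigma p <-> slice s p.
Proof.
  assert (FI := profile_first_integral a u Hu).
  destruct Hu as [u_pos H1 H2 Hode _ _ _].
  set (du := Derive u) in *. set (ddu := Derive du) in *.
  assert (u_derive : forall z, is_derive u z (du z)) by (intros; now apply Derive_correct).
  assert (du_derive : forall z, is_derive du z (ddu z)) by (intros; now apply Derive_correct).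
  (* Half the conserved quantity, so that the first integral takes the form
     [u'^2 = 1 - 2 m / u - u^2 / 3]; positive because [0 < a < 1]. *)
  set (m := (a - a ^ 3 / 3) / 2).
  assert (m_pos : 0 < m) by (unfold m; nra).
  assert (du_sqr : forall z, du z ^ 2 = 1 - 2 * m / u z - u z ^ 2 / 3).
  { intros z. generalize (u_pos z) (FI z); intros Hp E.
    replace (2 * m) with (u z * (1 - du z ^ 2) - u z ^ 3 / 3) by (rewrite E; unfold m; field).
    field; lra. }
  assert (ddu_eq : forall z, ddu z = m / u z ^ 2 - u z / 3).
  { intros z. generalize (u_pos z); intros Hp. rewrite Hode, du_sqr. field; lra. }
  assert (HL : dss_Lambda u = 2) by (apply (dss_Lambda_eq u du ddu); assumption).
  assert (Hslice : dss_hawking_mass_slice u r = m).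
  { unfold dss_hawking_mass_slice, dss_hawking_mass_graph, graph_surface. rewrite HL.
    (* The slice is encoded as the graph of the zero function, so its radius appears as [r + 0]. *)
    now apply (slice_mass u du ddu m (r + 0)). }
  assert (Hdr : du r ^ 2 < 1).
  { rewrite du_sqr. generalize (u_pos r); intros Hp.
    assert (0 < 2 * m / u r) by (apply Rdiv_lt_0_compat; lra).
    generalize (pow_lt _ 2 Hp); lra. }
  set (u0 := u r). assert (u0_pos : 0 < u0) by apply u_pos.
  (* The midpoint between [du r ^ 2] and 1: continuity keeps [du ^ 2] below it near [r], and it is
     itself below 1. *)
  set (kappa := (1 + du r ^ 2) / 2).
  assert (Hk : 0 <= kappa < 1 /\ du r ^ 2 < kappa)
    by (unfold kappa; generalize (pow2_ge_0 (du r)); lra).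
  set (c := 7 * u0 / (4 * m)).
  assert (Hc : 0 < c) by (apply Rdiv_lt_0_compat; lra).
  set (eta := Rmin (/ 20) ((1 - kappa) / 2 / (9 + c))).
  assert (Heta : 0 < eta <= / 20 /\ (9 + c) * eta <= (1 - kappa) / 2).
  { assert (0 < (1 - kappa) / 2 / (9 + c)) by (apply Rdiv_lt_0_compat; lra).
    split; [split; [apply Rmin_pos; lra | apply Rmin_l] |].
    apply Rle_trans with ((9 + c) * ((1 - kappa) / 2 / (9 + c))).
    - apply Rmult_le_compat_l; [lra | apply Rmin_r].
    - right; field; lra. }
  destruct Heta as [Heta Hsmall].
  assert (Hnear : locally r (fun z => Rabs (u z - u0) < eta * u0 /\ du z ^ 2 < kappa)).
  { assert (Hep : 0 < eta * u0) by (apply Rmult_lt_0_compat; lra).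
    apply filter_and.
    - apply (C1D_u u du u_derive r _ (locally_ball (u r) (mkposreal _ Hep))).
    - assert (Cd : C1D (fun z => du z ^ 2)) by (assert (C := C1D_du du ddu du_derive); c2d).
      apply (Cd r _ (open_lt kappa (du r ^ 2) (proj2 Hk))). }
  destruct Hnear as [d Hd].
  (* [d] confines the graph to the neighbourhood of [r] where [u] and [du] are controlled; [eta]
     bounds the gradient by [eta * u0]. *)
  exists (Rmin d eta). split; [apply Rmin_pos; [apply cond_pos | lra] |].
  intros phi Sigma Hphi Hnorm HSigma.
  assert (HX : forall s t, Rabs (phi (spherical s t)) < d
                 /\ gq (fr_b1 phi) (fr_b2 phi) s t <= eta ^ 2 * u0 ^ 2).
  { intros s t.
    destruct (C2_norm_lt (u r) _ phi (spherical s t) (u_pos r) Hnorm (spherical_dot s t)) as [N1 N2].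
    split; [apply Rlt_le_trans with (1 := N1), Rmin_l |].
    apply Rle_trans with (1 := frame_grad_norm phi Hphi s t).
    replace (eta ^ 2 * u0 ^ 2) with ((u0 * eta) ^ 2) by ring.
    apply pow_incr; split; [apply sqrt_pos |].
    apply Rle_trans with (u0 * Rmin d eta); [now apply Rlt_le |].
    apply Rmult_le_compat_l; [lra | apply Rmin_r]. }
  assert (Hfr := sphere_frame_of_C2 phi Hphi r).
  set (f := fun s t => r + phi (spherical s t)) in *.
  assert (Hfd : forall s t, Rabs (u (f s t) - u0) < eta * u0 /\ du (f s t) ^ 2 < kappa).
  { intros s t; apply Hd. change (Rabs (r + phi (spherical s t) - r) < d).
    replace (r + phi (spherical s t) - r) with (phi (spherical s t)) by ring. apply HX. }
  assert (Cq : C2D (gq (fr_b1 phi) (fr_b2 phi))).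
  { assert (C1 := sf_C1 _ _ _ _ _ _ Hfr). assert (C2 := sf_C2 _ _ _ _ _ _ Hfr).
    unfold gq; c2d. }
  (* The alternative of the theorem is decided by the Dirichlet energy: positive energy lowers the
     mass strictly, zero energy makes the graph a slice. *)
  destruct (Rle_lt_or_eq_dec _ _ (avg_ge_0 _ Cq (gq_pos (fr_b1 phi) (fr_b2 phi)))) as [Hlt | Heq].
  - left. rewrite Hslice. unfold dss_hawking_mass_graph. rewrite HL.
    apply (graph_mass_lt u du ddu u_pos u_derive du_derive m du_sqr ddu_eq f _ _ _ _ _ Hfr
             u0 eta kappa u0_pos Heta) with (c := c); try assumption; try reflexivity.
    + intros s t. destruct (Hfd s t) as [Hv _]. apply Rabs_def2 in Hv. lra.
    + intros; apply HX.
    + apply Hk.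
    + intros s t; left; apply Hfd.
  - right. exists (f 0 0). intros p. rewrite HSigma. unfold normal_graph, slice.
    assert (Hc2 : forall x, S2 x -> r + phi x = f 0 0).
    { intros x Hx. destruct (spherical_onto x Hx) as [s [t [Hs ->]]].
      apply (frame_constant _ _ _ _ _ _ Hfr (eq_sym Heq) s t Hs). }
    split; intros [Hp E]; (split; [assumption |]); rewrite E; [| symmetry]; now apply Hc2.
Qed.
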